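(* Let $n_1\ge n_2\ge\cdots\ge n_m\ge 0$ and $U=\mathrm{diag}(U_{n_1},\dots,U_{n_m})$. Every analytic solution $(h,g)$ of the equation $\nabla h=U\nabla g$ is $*$-analytic. In detail, let $(h,g)$ be an analytic solution, defined in a neighborhood of the origin, with $$g=\sum_{j=0}^{n_1}\left.\frac{\partial^j}{\partial\mu^j}\phi_j\!\left(\mathbf x^{(j)}_\mu\right)\right|_{\mu=0},$$ where $\phi_0,\phi_1,\dots,\phi_{n_1}$ are analytic functions near the origin with power series representations $$\phi_j(s_1,\dots,s_{\nu_j})=\sum_{I=(i_1,\dots,i_{\nu_j})\in\mathbb N^{\nu_j}}c_{I,j}\,s_1^{i_1}s_2^{i_2}\cdots s_{\nu_j}^{i_{\nu_j}} .$$ Then, in a neighborhood of the origin and up to an additive constant in $h$, $$V_0+\cdots+V_{n_1-2}\mu^{n_1-2}+h\mu^{n_1-1}+g\mu^{n_1}=\sum_{r=1}^m\ \sum_{I=(i_1,\dots,i_r)\in\mathbb N^r}(b_I)_\mu*(\mathbf x_\mu)^I_*$$ for some functions $V_0,\dots,V_{n_1-2}$, where for each multi-index $I=(i_1,\dots,i_r)\in\mathbb{N}^r$ $$(b_I)_\mu=\sum_{j=n_{r+1}+1}^{n_r}j!\,c_{I,j}\,\mu^{n_r-j}\qquad(n_{m+1}:=-1)$$ is a constant solution of the extended system $(-U+\mu I)\nabla V_\mu\equiv 0\pmod{\mu^{n_1+1}}$.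
   Context: Everything is over the complex numbers, and ''analytic'' means holomorphic. $\mathbb N=\{0,1,2,\dots\}$. $U_k$ is the $(k+1)\times(k+1)$ nilpotent Jordan block with ones on the first superdiagonal and zeros elsewhere. The independent variables are $\mathbf x=(\mathbf x^1,\dots,\mathbf x^m)$ with $\mathbf x^k=(x^k_0,\dots,x^k_{n_k})$ belonging to the block $U_{n_k}$; $\nabla$ is the column vector of partial derivatives in this order. For a parameter $\mu$, $$x^k_\mu=x^k_0+x^k_1\mu+\cdots+x^k_{n_k}\mu^{n_k},\quad \nu_j=\max\{i:n_i\ge j\},\quad \mathbf x^{(j)}_\mu=(x^1_\mu,\dots,x^{\nu_j}_\mu).$$ (Note $\nu_j=r$ exactly for $n_{r+1}+1\le j\le n_r$, so $c_{I,j}$ with $I\in\mathbb N^r$ makes sense for these $j$; an empty sum is $0$.) Extended systems. For $1\le s\le m$ the $s$-th extended subsystem is $\left(-\mathrm{diag}(U_{n_s},\dots,U_{n_m})+\mu I\right)\nabla V_\mu\equiv0\pmod{\mu^{n_s+1}}$ for $V_\mu=\sum_{i=0}^{n_s}V_i\mu^i$, $V_i$ functions of $\mathbf x^s,\dots,\mathbf x^m$; here $\equiv 0$ means divisibility of the polynomial in $\mu$ by $\mu^{n_s+1}$. The $*$-product of two solutions of the $s$-th subsystem is the remainder of their ordinary product modulo $\mu^{n_s+1}$. In the displayed series, $*$ between $(b_I)_\mu$ and $(\mathbf x_\mu)^I_*$ is the one for $s=1$ (modulo $\mu^{n_1+1}$). A solution is constant if its coefficients are constants, and simple if its coefficients are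 linear in the independent variables; each $x^s_\mu$ is a simple solution of the $s$-th subsystem. $*$-powers. For simple solutions $y^s_\mu$ of the $s$-th subsystem, $s=1,\dots,r$, and $I=(i_1,\dots,i_r)\in\mathbb N^r$, let $P_r$ be the remainder of $(y^r_\mu)^{i_r}$ modulo $\mu^{n_r+1}$, and for $s=r-1,\dots,1$ let $P_s$ be the remainder of $(y^s_\mu)^{i_s}\mu^{n_s-n_{s+1}}P_{s+1}$ modulo $\mu^{n_s+1}$; put $(\mathbf y_\mu)^I_*:=P_1$. The $*$-power $(\mathbf x_\mu)^I_*$ is the case $y^s_\mu=x^s_\mu$; written out, $(\mathbf x_\mu)^I_*=(x^1_\mu)^{i_1}_**\left(\mu^{n_1-n_2}(x^2_\mu)^{i_2}_**\cdots*\left(\mu^{n_{r-1}-n_r}(x^r_\mu)^{i_r}_*\right)\right)$, evaluated from the innermost factor outwards. A solution $(h,g)$ of $\nabla h=U\nabla g$ is $*$-analytic if, around every point of its domain (taken as origin after translation), there is a finite sum $V_\mu$ of convergent series $\sum_{I\in\mathbb N^r}(b_I)_\mu*(\mathbf y_\mu)^I_*$ ($1\le r\le m$, $(b_I)_\mu$ constant solutions of the first subsystem, $y^s_\mu$ simple solutions of the $s$-th subsystem) such that $g$ is the coefficient of $\mu^{n_1}$ and $h$ the coefficient of $\mu^{n_1-1}$ in $V_\mu$. If $n_1=0$, then $h$ is a constant and only the condition on $g$ is imposed; similarly the left-hand side of the displayed representation is then just $g$. *)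

(* Defs.v *)
From HB Require Import structures.
From mathcomp Require Import all_boot all_order all_algebra.
From mathcomp Require Import all_classical all_reals all_analysis.
From mathcomp Require Import complex.
From mathcomp.analysis.showcase Require Import summability.

Set Implicit Arguments.
Unset Strict Implicit.
Unset Printing Implicit Defensive.

Import Order.TTheory GRing.Theory Num.Theory numFieldNormedType.Exports.

Local Open Scope classical_set_scope.
Local Open Scope ring_scope.
Local Open Scope complex_scope.

(* Packing R[i] as a numFieldType gives it, and row vectors over it, the
   topology of the modulus. *)
Definition Cplx (R : realType) : numFieldType := R[i].

Section Series.
Variable K : numFieldType.

(* Unordered (equivalently, absolutely convergent) sums: the net of the sums
   over finite subsets of the index type converges to [l]. *)
Definition has_sum (T : choiceType) (F : T -> K) (l : K) : Prop :=
  partial_sum F @ totally --> l.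

Definition has_poly_sum (T : choiceType) (F : T -> {poly K})
    (P : {poly K}) : Prop :=
  forall k : nat, has_sum (fun t => (F t)`_k) P`_k.

Definition monomial (N : nat) (x : 'rV[K]_N) (I : N.-tuple nat) : K :=
  \prod_(k < N) x 0 k ^+ tnth I k.

Definition has_power_series (N : nat) (c : N.-tuple nat -> K)
    (f : 'rV[K]_N -> K) (p : 'rV[K]_N) : Prop :=
  \forall x \near p, has_sum (fun I => c I * monomial (x - p) I) (f x).

(* Holomorphy in several complex variables, in the sense of local expansions
   into convergent power series. *)
Definition analytic_on (N : nat) (D : set 'rV[K]_N)
    (f : 'rV[K]_N -> K) : Prop :=
  forall p, D p -> exists c, has_power_series c f p.

Definition grad (N : nat) (f : 'rV[K]_N -> K) (x : 'rV[K]_N) :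
    'cV[K]_N :=
  \col_k 'D_(delta_mx 0 k) f x.

End Series.

(* Blocks are numbered from 0: block [k < m] here is the (k+1)-st block of the
   mathematical text and has size [(n k).+1]; values [n k] with [m <= k] are
   never used. *)
Section Blocks.
Variables (K : numFieldType) (m : nat) (n : nat -> nat).

Definition nvars : nat := \sum_(k < m) (n k).+1.

Definition jordan (k : nat) : 'M[K]_k.+1 :=
  \matrix_(i, j) (j == i.+1 :> nat)%:R.

Definition Umx : 'M[K]_nvars := \mxdiag_(k < m) jordan (n k).

Definition analytic_solution (D : set 'rV[K]_nvars)
    (h g : 'rV[K]_nvars -> K) : Prop :=
  [/\ analytic_on D h, analytic_on D g &
      forall x, D x -> grad h x = Umx *m grad g x].

Definition block (x : 'rV[K]_nvars) (k : 'I_m) : 'rV[K]_(n k).+1 :=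
  @submxrow _ m (fun k : 'I_m => (n k).+1) 1 x k.

(* The polynomial x^k_mu in the indeterminate mu = 'X; 0 for [m <= k]. *)
Definition xpol (x : 'rV[K]_nvars) (k : nat) : {poly K} :=
  if insub k is Some k' then rVpoly (block x k') else 0.

Definition nu (j : nat) : nat := \max_(i < m | (j <= n i)%N) i.+1.

Definition xeval (j : nat) (x : 'rV[K]_nvars) (mu : K) :
    'rV[K]_(nu j) :=
  \row_(k < nu j) (xpol x k).[mu].

Definition gradpoly (d : nat) (V : 'rV[K]_nvars -> {poly K})
    (x : 'rV[K]_nvars) : 'cV[{poly K}]_nvars :=
  \col_i \poly_(k < d.+1) grad (fun z => (V z)`_k) x i 0.

(* Functions of the blocks s, s+1, ... are encoded as functions of all the
   variables that depend on these blocks only.  As U is block diagonal and the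
   partial derivatives of such a V in the earlier blocks vanish, the rows of
   (- U + mu I) grad V in the blocks s, s+1, ... are exactly the entries of
   (- diag (U_(n s), U_(n (s+1)), ...) + mu I) grad V. *)
Definition ext_solution (s : nat) (V : 'rV[K]_nvars -> {poly K}) :
    Prop :=
  [/\ forall x, (size (V x) <= (n s).+1)%N,
      forall k, analytic_on setT (fun x => (V x)`_k),
      forall x x', (forall k : 'I_m, (s <= k)%N -> block x k = block x' k) ->
        V x = V x' &
      forall x (k : 'I_m) (i : 'I_(n k).+1), (s <= k)%N ->
        'X^((n s).+1) %|
          ((- map_mx polyC Umx + ('X)%:M) *m gradpoly (n s) V x)
             (tagnat.Rank k i) 0].

Definition constant_solution (s : nat) (b : {poly K}) : Prop :=
  ext_solution s (fun=> b).

Definition simple_solution (s : nat) (y : 'rV[K]_nvars -> {poly K}) :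
    Prop :=
  ext_solution s y /\ forall k, scalar (fun x => (y x)`_k).

Definition star (s : nat) (p q : {poly K}) : {poly K} :=
  (p * q) %% 'X^((n s).+1).

(* With I = [:: i_s; ...; i_r], this is P_s; the *-power is [starpow 0 y I].
   The value on the empty sequence is irrelevant. *)
Fixpoint starpow (s : nat) (y : nat -> {poly K}) (I : seq nat) :
    {poly K} :=
  match I with
  | [::] => 1
  | [:: i] => y s ^+ i %% 'X^((n s).+1)
  | i :: I' =>
      (y s ^+ i * 'X^(n s - n s.+1) * starpow s.+1 y I') %% 'X^((n s).+1)
  end.

(* The analytic solution (h, g) on D is *-analytic: near each point p of D it
   is given by a finite sum, indexed by t, of convergent series; the t-th
   series is indexed by multi-indices of length [r t]. *)
Definition star_analytic (D : set 'rV[K]_nvars)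
    (h g : 'rV[K]_nvars -> K) : Prop :=
  forall p, D p ->
  exists (T : nat) (r : 'I_T -> nat) (b : 'I_T -> seq nat -> {poly K})
         (y : 'I_T -> nat -> 'rV[K]_nvars -> {poly K}),
  [/\ forall t, (1 <= r t <= m)%N,
      forall t (I : (r t).-tuple nat), constant_solution 0 (b t I),
      forall t s, (s < r t)%N -> simple_solution s (y t s) &
      \forall x \near (0 : 'rV[K]_nvars),
      exists V : 'I_T -> {poly K},
      [/\ forall t, has_poly_sum
            (fun I : (r t).-tuple nat =>
               star 0 (b t I) (starpow 0 (fun s => y t s x) I)) (V t),
          g (p + x) = (\sum_t V t)`_(n 0%N) &
          (0 < n 0)%N -> h (p + x) = (\sum_t V t)`_(n 0%N).-1]].

(* n_(r+1) + 1 for the block r, with the convention n_(m+1) = -1. *)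
Definition next_lower (r : nat) : nat :=
  if (r.+1 < m)%N then (n r.+1).+1 else 0%N.

(* (b_I)_mu for a multi-index I of length r+1. *)
Definition bpol (c : seq nat -> nat -> K) (r : nat) (I : seq nat) :
    {poly K} :=
  \sum_(next_lower r <= j < (n r).+1) (j`!%:R * c I j) *: 'X^(n r - j).

(* V_0 + ... + V_(n1-2) mu^(n1-2) + h mu^(n1-1) + g mu^n1, which is g if
   n1 = 0. *)
Definition lhs_pol (V : nat -> K) (h g : K) : {poly K} :=
  if n 0%N is d.+1 then \sum_(k < d) V k *: 'X^k + h *: 'X^d + g *: 'X^(d.+1)
  else g%:P.

End Blocks.

(* Main.v *)
Require Import Defs.
From HB Require Import structures.
From mathcomp Require Import all_boot all_order all_algebra.
From mathcomp Require Import all_classical all_reals all_analysis.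
From mathcomp Require Import finmap complex ring zify.
From mathcomp.analysis.showcase Require Import summability.

(** Near a point, expand [g] and [h] in power series, and call weight of a
    variable its index in its block. In terms of derivatives at the point, the
    equation says that a derivative of [h] which involves a variable is the
    derivative of [g] with this variable replaced by the next one of its block,
    or 0 if there is no next one. Comparing two ways of raising an index in the
    same derivative of [h], one sees that a unit of weight may be moved from one
    variable to another without changing the derivative of [g], and that this
    derivative is 0 as soon as weight can be pushed beyond the end of a block
    ([taylor_gather]). Hence a derivative of [g] depends only on the degrees [I]
    in the blocks and on the total weight [j], and it vanishes unless [j] fits
    in every block that is involved ([taylor_invariant], [taylor_vanish]). The
    derivatives of [h] are those of [g] with the weight raised by one.

    By the multinomial theorem ([fiber_sum]), the monomials of block degrees [I]
    and weight [j], with their multiplicities, sum up to the coefficient of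
    [mu ^ j] in the product of the powers of the [x^k_mu]. On the other hand,
    the star power with exponents [I] is [mu ^ (n_1 - n_r)] times this product,
    modulo [mu ^ (n_1 + 1)] ([coef_starpow]), so the coefficient of
    [mu ^ n_1] in its star product with [b_I] is the sum over [j] of
    [j! c_(I,j)] times the coefficient of [mu ^ j] in the product
    ([coef_star_bpol]). The coefficient of [mu ^ (n_1 - 1)] is obtained
    similarly, with the weight lowered by one. So, with the [c_(I,j)] read off
    from the derivatives of [g] ([ccoef]), the star series gives [g] and [h];
    the constant term of [h] is provided by the choice of [c_(0,1)].

    If the functions [phi_j] are given, the same computation at numbers [mu]
    ([derive1n_phi]) shows that the expansion of [g] is the one obtained from
    the [c_(I,j)]; then all the coefficients of [h] but the constant term are
    those of the star series, as they are determined by [g] ([star_coef_rel]).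

    Convergence is a matter of geometric bounds for coefficients
    ([power_series_bound], [block_coef_bound]): all the families that occur are
    absolutely summable near the point, and may be regrouped at will
    ([has_sum_fibers]). The identification of coefficients rests on termwise
    differentiation ([power_series_derivative], [power_series_unique]). *)

Set Implicit Arguments.
Unset Strict Implicit.
Unset Printing Implicit Defensive.

Import Order.TTheory GRing.Theory Num.Theory numFieldNormedType.Exports.

Local Open Scope classical_set_scope.
Local Open Scope ring_scope.

#[local] Existing Instance totally_filter.

(** * Unordered sums *)

Section Sums.
Variable K : numFieldType.
Implicit Types T S : choiceType.

Lemma has_sumP T (F : T -> K) l :
  has_sum F l <->
  forall e, 0 < e -> exists A : {fset T}, forall B : {fset T},
    (A `<=` B)%fset -> `|l - \sum_(t <- B) F t| < e.
Proof.
rewrite /has_sum; split=> [/cvgrPdist_lt H e e0|H].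
  have [A _ HA] := H e e0; exists A => B AB.
  by move: (HA B AB); rewrite /partial_sum /= big_seq_fsetE.
apply/cvgrPdist_lt => e e0; have [A HA] := H e e0.
by exists A => // B AB; rewrite /partial_sum -(big_seq_fsetE _ _ xpredT F); exact: HA.
Qed.

Lemma has_sum_unique T (F : T -> K) l l' :
  has_sum F l -> has_sum F l' -> l = l'.
Proof. exact: cvg_unique. Qed.

Lemma partial_sumE T (F : T -> K) A : partial_sum F A = \sum_(t <- A) F t.
Proof. by rewrite /partial_sum big_seq_fsetE. Qed.

Lemma eq_has_sum T (F G : T -> K) l : F =1 G -> has_sum F l -> has_sum G l.
Proof. by move=> /funext ->. Qed.

Lemma has_sumD T (F G : T -> K) a b :
  has_sum F a -> has_sum G b -> has_sum (fun t => F t + G t) (a + b).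
Proof.
rewrite /has_sum => Fa Gb.
have -> : partial_sum (fun t => F t + G t) = partial_sum F + partial_sum G.
  by apply/funext => A; rewrite fctE !partial_sumE big_split.
exact: cvgD.
Qed.

Lemma has_sumZ T (F : T -> K) k a :
  has_sum F a -> has_sum (fun t => k * F t) (k * a).
Proof.
rewrite /has_sum => Fa.
have -> : partial_sum (fun t => k * F t) = (fun A => k * partial_sum F A).
  by apply/funext => A; rewrite !partial_sumE big_distrr.
by apply: cvgM => //; exact: cvg_cst.
Qed.

Lemma has_sumB T (F G : T -> K) a b :
  has_sum F a -> has_sum G b -> has_sum (fun t => F t - G t) (a - b).
Proof.
move=> Fa /(has_sumZ (k := -1)) Gb; rewrite -[- b]mulN1r.
by apply: eq_has_sum (has_sumD Fa Gb) => t; rewrite mulN1r.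
Qed.

Lemma has_sum_seq T (F : T -> K) (s : seq T) : uniq s ->
  (forall t, t \notin s -> F t = 0) -> has_sum F (\sum_(t <- s) F t).
Proof.
move=> us F0; apply/has_sumP => e e0.
exists [fset t | t in s]%fset => B sB.
suff -> : \sum_(t <- B) F t = \sum_(t <- s) F t by rewrite subrr normr0.
rewrite (bigID (mem s)) /= [X in _ + X]big1 => [|t]; last exact: F0.
rewrite addr0 -big_filter; apply: perm_big; apply: uniq_perm => //.
  by rewrite filter_uniq.
move=> t; rewrite mem_filter andb_idr// => ts.
by apply: (fsubsetP sB); rewrite !inE.
Qed.

Lemma has_sum0 T : has_sum (fun _ : T => 0 : K) 0.
Proof. by have := @has_sum_seq T (fun=> 0) [::] isT (fun _ _ => erefl); rewrite big_nil. Qed.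

Lemma has_sum_big T (J : Type) (r : seq J) (P : pred J) (F : J -> T -> K) (a : J -> K) :
  (forall j, P j -> has_sum (F j) (a j)) ->
  has_sum (fun t => \sum_(j <- r | P j) F j t) (\sum_(j <- r | P j) a j).
Proof.
move=> Fa; elim: r => [|j r IH].
  by rewrite big_nil; apply: eq_has_sum (has_sum0 T) => t; rewrite big_nil.
rewrite big_cons; case: ifPn => Pj.
  by apply: eq_has_sum (has_sumD (Fa j Pj) IH) => t; rewrite big_cons Pj.
by apply: eq_has_sum IH => t; rewrite big_cons (negbTE Pj).
Qed.

Lemma has_sum_norm_le T (F : T -> K) l e : has_sum F l ->
  (forall A : {fset T}, `|\sum_(t <- A) F t| <= e) -> `|l| <= e.
Proof.
move=> /has_sumP Fl Fe.
have e0 : 0 <= e by apply: le_trans (Fe fset0).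
rewrite real_leNgt ?ger0_real//; apply/negP => el.
have [|A /(_ A (fsubset_refl _)) HA] := Fl (`|l| - e); first by rewrite subr_gt0.
have := le_lt_trans (lerB_dist _ _) HA.
by rewrite ltrD2l ltrN2 (le_gtF (Fe A)).
Qed.

(** Bounded finite sums of moduli: over the complex numbers this amounts to
    unordered summability, and it can be established by domination. *)
Definition abs_summable T (F : T -> K) :=
  exists B : K, forall A : {fset T}, \sum_(t <- A) `|F t| <= B.

Lemma abs_summable_le T (F G : T -> K) :
  abs_summable G -> (forall t, `|F t| <= `|G t|) -> abs_summable F.
Proof.
move=> [B GB] FG; exists B => A; apply: le_trans (GB A).
exact: ler_sum.
Qed.

Lemma abs_summableZ T (F : T -> K) k :
  abs_summable F -> abs_summable (fun t => k * F t).
Proof.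
move=> [B FB]; exists (`|k| * B) => A.
under eq_bigr do rewrite normrM.
by rewrite -big_distrr ler_wpM2l.
Qed.

End Sums.

Section ComplexSums.
Variable R : realType.
Local Notation K := (Cplx R).
Implicit Types T S : choiceType.
Local Open Scope complex_scope.

(** The sum is the supremum of the finite partial sums. *)
Lemma nonneg_has_sum T (f : T -> R) : (forall t, 0 <= f t) ->
  abs_summable f -> exists a, has_sum f a.
Proof.
move=> f0 [B fB].
have fB' (A : {fset T}) : \sum_(t <- A) f t <= B.
  by apply: le_trans (fB A); apply: ler_sum => t _; exact: ler_norm.
pose E := [set \sum_(t <- (A : {fset T})) f t | A in setT].
have supE : has_sup E.
  split; first by exists (\sum_(t <- fset0) f t), fset0.
  by exists B => _ [A _ <-].
exists (sup E); apply/has_sumP => e e0.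
have [_ [A _ <-] HA] := sup_adherent e0 supE.
exists A => C AC.
have CE : \sum_(t <- C) f t <= sup E.
  by apply: ub_le_sup; [case: supE | exists C].
rewrite ger0_norm ?subr_ge0// ltrBlDl -ltrBlDr.
apply: (lt_le_trans HA).
rewrite [leRHS](bigID (fun t => t \in A)) /= -[leLHS]addr0.
apply: lerD; last exact: sumr_ge0.
rewrite -[leRHS]big_filter le_eqVlt; apply/orP; left; apply/eqP.
apply: perm_big; apply: uniq_perm => //; first by rewrite filter_uniq.
by move=> t; rewrite mem_filter andb_idr// => /(fsubsetP AC).
Qed.

(** A real term is the difference of the nonnegative terms [`|f t|] and
    [`|f t| - f t]. *)
Lemma real_has_sum T (f : T -> R) : abs_summable f -> exists a, has_sum f a.
Proof.
move=> fs.
have [a fa] : exists a, has_sum (fun t => `|f t|) a.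
  by apply: nonneg_has_sum => //; apply: abs_summable_le fs _ => t; rewrite normr_id.
have [b fb] : exists b, has_sum (fun t => `|f t| - f t) b.
  apply: nonneg_has_sum => [t|]; first by rewrite subr_ge0 ler_norm.
  apply: (abs_summable_le (abs_summableZ 2 fs)) => t.
  rewrite normrM normr_nat [leLHS]ger0_norm ?subr_ge0 ?ler_norm//.
  have := ler_norm (- f t); rewrite normrN. rewrite mulr_natl mulr2n lerD2l => h. exact: h.
exists (a - b); apply: eq_has_sum (has_sumB fa fb) => t.
by rewrite opprB addrC subrK.
Qed.

Lemma has_sum_real_complex T (f : T -> R) a :
  has_sum f a -> has_sum (fun t => (f t)%:C : K) a%:C.
Proof.
move=> /has_sumP fa; apply/has_sumP => e e0.
have eE : e = (complex.Re e)%:C.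
  by rewrite (@RRe_real R) //; exact: gtr0_real.
have [|A HA] := fa (complex.Re e); first by rewrite -ltcR -eE.
exists A => B AB; rewrite eE.
have -> : \sum_(t <- B) (f t)%:C = (\sum_(t <- B) f t)%:C :> K.
  by rewrite rmorph_sum.
have -> : a%:C - (\sum_(t <- B) f t)%:C = (a - \sum_(t <- B) f t)%:C :> K.
  by rewrite rmorphB.
rewrite normc_def /= expr0n addr0 sqrtr_sqr ltcR; exact: HA.
Qed.

Lemma abs_summable_Re T (F : T -> K) : abs_summable F ->
  abs_summable (fun t => complex.Re (F t)).
Proof.
move=> [B FB]; exists (complex.Re B) => A.
have /= := FB A; rewrite lecE => /andP[_]; apply: le_trans.
have -> : complex.Re (\sum_(t <- A) `|F t|) = \sum_(t <- A) complex.Re `|F t|.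
  elim/big_rec2: _ => [//|t x y _ <-].
  by case: `|F t|; case: y.
apply: ler_sum => t _.
by have := normc_ge_Re (F t); rewrite lecE => /andP[_].
Qed.

(** Completeness of the complex numbers, reduced to real families through
    real and imaginary parts. *)
Lemma summable_has_sum T (F : T -> K) : abs_summable F -> exists l, has_sum F l.
Proof.
move=> Fs.
have [a Fa] := real_has_sum (abs_summable_Re Fs).
have [b Fb] := real_has_sum (abs_summable_Re (abs_summableZ (- 'i : K) Fs)).
exists (a%:C + ('i : K) * b%:C).
apply: eq_has_sum (has_sumD (has_sum_real_complex Fa)
  (has_sumZ (k := 'i : K) (has_sum_real_complex Fb))) => t.
rewrite [RHS](@complexE R) mulNr; congr (_ + _ * (_)%:C).
by case: (F t) => x y /=; rewrite mul0r mul1r sub0r opprK.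
Qed.

(** The indices outside a large finite set contribute little, uniformly in
    the finite sums that are taken there; this is what allows regrouping. *)
Lemma abs_summable_tail T (F : T -> K) : abs_summable F -> forall e, 0 < e ->
  exists A : {fset T}, forall B : {fset T},
    \sum_(t <- B | t \notin A) `|F t| <= e.
Proof.
move=> Fs e e0.
have [|s] := @summable_has_sum _ (fun t => `|F t|).
  by apply: abs_summable_le Fs _ => t; rewrite normr_id.
move=> /has_sumP Hs.
have [|A HA] := Hs (e / 2); first by rewrite divr_gt0.
exists A => B.
have -> : \sum_(t <- B | t \notin A) `|F t| =
    \sum_(t <- (A `|` B)%fset) `|F t| - \sum_(t <- A) `|F t|.
  rewrite [X in _ = X - _](bigID (fun t => t \in A)) /=.
  have -> : \sum_(t <- (A `|` B)%fset | t \in A) `|F t| = \sum_(t <- A) `|F t|.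
    rewrite -big_filter; apply: perm_big; apply: uniq_perm => //.
      by rewrite filter_uniq.
    by move=> t; rewrite mem_filter inE andb_idr// => ->.
  rewrite addrC addrK -big_filter -[RHS]big_filter.
  apply: perm_big; apply: uniq_perm; rewrite ?filter_uniq// => t.
  by rewrite !mem_filter inE; case: (t \in A).
set X := \sum_(t <- (A `|` B)%fset) _; set Y := \sum_(t <- A) _.
have XY : X - Y = (s - Y) - (s - X) by rewrite opprB [RHS]addrC addrA subrK.
apply: le_trans (real_ler_norm _) _.
  by rewrite rpredB//; apply: ger0_real; apply: sumr_ge0.
rewrite XY [e]splitr; apply: le_trans (ler_normB _ _) _.
by apply: lerD; apply: ltW; apply: HA; rewrite ?fsubsetUl ?fsubset_refl.
Qed.

(** Regrouping along the fibres of [pi]. A finite sum of the [G s] that covers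
    the images of the indices in [A] differs from [l] by terms of index outside
    [A], hence by little once [A] is chosen by [abs_summable_tail]. *)
Lemma has_sum_fibers T S (pi : T -> S) (F : T -> K) (G : S -> K) l :
  abs_summable F -> has_sum F l ->
  (forall s, has_sum (fun t => if pi t == s then F t else 0) (G s)) ->
  has_sum G l.
Proof.
move=> Fs Fl FG; apply/has_sumP => e e0.
have [|A HA] := abs_summable_tail Fs (e := e / 2); first by rewrite divr_gt0.
exists [fset pi t | t in A]%fset => B AB.
have H := has_sumB Fl (has_sum_big (r := B) (P := xpredT) (fun s _ => FG s)).
apply: (@le_lt_trans _ _ (e / 2)); last first.
  by rewrite ltr_pdivrMr// ltr_pMr// (ltr_nat K 1 2).
apply: has_sum_norm_le H _ => C; apply: le_trans (HA C).
apply: le_trans (ler_norm_sum _ _ _) _.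
rewrite [leRHS]big_mkcond /=; apply: ler_sum => t _.
have -> : \sum_(s <- B) (if pi t == s then F t else 0) =
    if pi t \in B then F t else 0.
  rewrite -big_mkcond /=; case: ifPn => tB.
    rewrite (big_rem (pi t)) //= eqxx big1_seq ?addr0// => s /andP[/eqP <-].
    by rewrite mem_rem_uniqF.
  by rewrite big1_seq// => s /andP[/eqP <-]; rewrite (negbTE tB).
case: ifPn => tB; first by rewrite subrr normr0; case: ifP.
rewrite subr0 ifT//; apply: contra tB => tA; apply: (fsubsetP AB).
by apply/imfsetP; exists t.
Qed.

(** The case in which every fibre carries finitely many nonzero terms, so that
    no convergence has to be known inside the fibres. *)
Lemma has_sum_finite_fibers T S (pi : T -> S) (fib : S -> seq T)
    (F : T -> K) (G : S -> K) l :
  abs_summable F -> has_sum F l ->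
  (forall s, uniq (fib s)) ->
  (forall t, F t != 0 -> t \in fib (pi t)) ->
  (forall s, \sum_(t <- fib s | pi t == s) F t = G s) ->
  has_sum G l.
Proof.
move=> Fs Fl ufib fibP FG; apply: has_sum_fibers Fs Fl _ => s.
rewrite -FG big_mkcond; apply: has_sum_seq => // t.
by case: eqP => // <-; apply: contraNeq; exact: fibP.
Qed.

End ComplexSums.

(** * Multi-indices in a box and the multinomial theorem *)

Section Boxes.

(** Multi-indices with entries below [B], listed so that an induction on the
    number of variables turns a sum over a box into an iterated sum. *)
Fixpoint box (N B : nat) : seq (N.-tuple nat) :=
  if N is N'.+1 then allpairs (fun a (al : N'.-tuple nat) => [tuple of a :: al]) (iota 0 B) (box N' B)
  else [:: [tuple]].

Lemma mem_box N B (al : N.-tuple nat) :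
  (al \in box N B) = [forall v, (tnth al v < B)%N].
Proof.
elim: N al => [|N IH] al /=.
  by rewrite inE [al]tuple0 [X in _ = X](introT forallP) => [|[]//]; exact/eqP.
apply/allpairsP/forallP => [[[a be] /= [aB beB ->]] v|alB].
  move: aB beB; rewrite mem_iota IH => aB /forallP beB.
  by case: (unliftP ord0 v) => [w|] ->; rewrite ?tnthS ?tnth0.
exists (thead al, [tuple of behead al]); split => /=.
- by rewrite mem_iota; exact: alB.
- by rewrite IH; apply/forallP => v; rewrite tnth_behead; exact: alB.
- exact: tuple_eta.
Qed.

Lemma box_uniq N B : uniq (box N B).
Proof.
elim: N => //= N IH; apply: allpairs_uniq; rewrite ?iota_uniq//.
by move=> [a al] [b be] _ _ /= [-> /val_inj ->].
Qed.

Lemma big_box (V : Type) (idx : V) (op : Monoid.com_law idx) N B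
    (P : pred (N.+1.-tuple nat)) (F : N.+1.-tuple nat -> V) :
  \big[op/idx]_(al <- box N.+1 B | P al) F al =
  \big[op/idx]_(a < B) \big[op/idx]_(al <- box N B | P [tuple of val a :: al]) F [tuple of val a :: al].
Proof.
rewrite /= big_mkcond big_allpairs_dep /= -(subn0 B) -/(index_iota 0 B) big_mkord subn0.
by apply: eq_bigr => a _; rewrite -big_mkcond.
Qed.

Lemma sum_box_prod (A : comNzSemiRingType) N B (f : 'I_N -> nat -> A) :
  \sum_(al <- box N B) \prod_(v < N) f v (tnth al v) = \prod_(v < N) \sum_(a < B) f v a.
Proof.
elim: N f => [|N IH] f; first by rewrite big_ord0 /= big_seq1 big_ord0.
rewrite big_box big_ord_recl big_distrl; apply: eq_bigr => a _ /=.
rewrite -(IH (fun v => f (lift ord0 v))) big_distrr; apply: eq_bigr => al _ /=.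
by rewrite big_ord_recl tnth0; congr (_ * _); apply: eq_bigr => v _; rewrite tnthS.
Qed.

End Boxes.

Definition bdeg N (blk : 'I_N -> nat) (k : nat) (al : N.-tuple nat) : nat :=
  \sum_(v < N | blk v == k) tnth al v.

Section Multinomial.
Variables (K : numFieldType) (A : comNzRingType) (f : {rmorphism K -> A}).

(** Divided powers, in terms of which the multinomial theorem is free of
    coefficients. The morphism [f] provides the rational scalars of [A], which
    is either [K] or a polynomial ring over [K] below. *)
Definition dpow (a : nat) (x : A) : A := f a`!%:R^-1 * x ^+ a.

Lemma dpow0 a : dpow a 0 = (a == 0%N)%:R.
Proof. by case: a => [|a]; rewrite /dpow ?expr0n ?invr1 ?rmorph1 ?mulr1 ?mulr0. Qed.

Lemma dpowD d x y : dpow d (x + y) = \sum_(a < d.+1) dpow a x * dpow (d - a) y.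
Proof.
rewrite /dpow addrC exprDn big_distrr; apply: eq_bigr => a _ /=.
have ad : (a <= d)%N by rewrite -ltnS.
rewrite [RHS]mulrACA -rmorphM mulrnAr -mulrnAl -raddfMn -[_ *+ 'C(_, _)]mulr_natl.
rewrite [y ^+ _ * _]mulrC; congr (f _ * _).
rewrite -(bin_fact ad) !natrM !invfM mulVKf//.
by rewrite pnatr_eq0 -lt0n bin_gt0.
Qed.

(** Induction on the number of variables: splitting off the first variable
    affects the factor of its own block only, where it is the binomial theorem
    [dpowD]. Exponents are at most block degrees, so the box contains all the
    monomials of block degrees [I]. *)
Lemma multinomial m N B (blk : 'I_N -> nat) (y : 'I_N -> A) (I : nat -> nat) :
  (forall v, (blk v < m)%N) -> (forall k, (k < m)%N -> (I k < B)%N) ->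
  \sum_(al <- box N B | [forall k : 'I_m, bdeg blk k al == I k])
     \prod_(v < N) dpow (tnth al v) (y v) =
  \prod_(k < m) dpow (I k) (\sum_(v < N | blk v == k) y v).
Proof.
elim: N blk y I => [|N IH] blk y I blkm IB.
  rewrite /= big_mkcond big_seq1 big_ord0; under [RHS]eq_bigr do rewrite big_ord0 dpow0.
  case: ifPn => [/forallP H|].
    rewrite big1// => k _; have := H k; rewrite /bdeg big_ord0 => /eqP <-.
    by [].
  rewrite negb_forall => /existsP[k]; rewrite /bdeg big_ord0 eq_sym => H.
  by rewrite (bigD1 k)//= (negbTE H) mul0r.
pose blk' v := blk (lift ord0 v); pose b0 := Ordinal (blkm ord0).
pose S' k := \sum_(v < N | blk' v == k) y (lift ord0 v).
have degS a (al : N.-tuple nat) k :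
    bdeg blk k [tuple of a :: al] = ((if blk ord0 == k then a else 0) + bdeg blk' k al)%N.
  rewrite /bdeg big_mkcond big_ord_recl /= tnth0 [in RHS]big_mkcond; congr addn.
  by apply: eq_bigr => v _; rewrite tnthS.
have SE k : \sum_(v < N.+1 | blk v == k) y v =
    (if blk ord0 == k then y ord0 else 0) + S' k.
  by rewrite big_mkcond big_ord_recl /S' [in RHS]big_mkcond.
rewrite big_box [RHS](bigD1 b0)//= SE eqxx dpowD big_distrl /=.
rewrite (big_ord_widen B (fun a => dpow a (y ord0) * dpow (I b0 - a) (S' b0) *
  \prod_(i < m | i != b0) dpow (I i) (\sum_(v < N.+1 | blk v == i) y v))) ?IB//.
rewrite [RHS]big_mkcond; apply: eq_bigr => a _.
have bP (k : 'I_m) : (blk ord0 == k) = (k == b0) by rewrite eq_sym.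
(* The first variable takes [a] out of the degree of its block, if possible. *)
case: ltnP => aI.
  pose I' k := (I k - (if blk ord0 == k then val a else 0))%N.
  rewrite (eq_bigl (fun al => [forall k : 'I_m, bdeg blk' k al == I' k])); last first.
    move=> al; apply: eq_forallb => k; rewrite degS /I'.
    case: (blk ord0 =P k) => [E|_]; last by rewrite add0n subn0.
    by rewrite -[RHS](eqn_add2l a) subnKC// -E.
  under eq_bigr do rewrite big_ord_recl tnth0.
  under eq_bigr do under eq_bigr do rewrite tnthS.
  rewrite -big_distrr /= IH; last 2 first.
    by move=> v; exact: blkm.
    by move=> k km; rewrite /I'; apply: leq_ltn_trans (leq_subr _ _) (IB k km).
  rewrite /= -[RHS]mulrA; congr (_ * _); rewrite (bigD1 b0)//= /I' eqxx; congr (_ * _).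
  by apply: eq_bigr => k kb; rewrite SE bP (negbTE kb) subn0 add0r.
rewrite big1// => al /forallP /(_ b0); rewrite degS /= eqxx => /eqP E.
by move: aI; rewrite -E -ltnS ltnNge ltnS leq_addr.
Qed.

End Multinomial.

Section MultiCoef.
Variables (K : numFieldType) (m N : nat) (blk : 'I_N -> nat).

(** The multiplicity of the monomial [al] in the product over [k] of the
    powers [(\sum_(v | blk v == k) x v) ^+ bdeg blk k al]. *)
Definition multicoef (al : N.-tuple nat) : K :=
  \prod_(k < m) (bdeg blk k al)`!%:R * \prod_(v < N) (tnth al v)`!%:R^-1.

Lemma multicoef_ge0 al : 0 <= multicoef al.
Proof. by rewrite mulr_ge0// prodr_ge0// => v _; rewrite invr_ge0 ler0n. Qed.

Lemma bdeg_sum al : (forall v, (blk v < m)%N) ->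
  (\sum_(k < m) bdeg blk k al = \sum_(v < N) tnth al v)%N.
Proof.
move=> blkm; rewrite /bdeg (exchange_big_dep xpredT)//=; apply: eq_bigr => v _.
by rewrite (big_pred1 (Ordinal (blkm v)))//= => k; rewrite eq_sym.
Qed.

(** At the point all of whose coordinates are 1, the terms of the multinomial
    expansion are nonnegative, so each of them is at most the whole sum. *)
Lemma multicoef_le al : (forall v, (blk v < m)%N) ->
  multicoef al <= N%:R ^+ (\sum_(v < N) tnth al v).
Proof.
move=> blkm; pose B := (\sum_(v < N) tnth al v).+1.
have alB v : (tnth al v < B)%N by rewrite ltnS (bigD1 v)//= leq_addr.
have degB k : (k < m)%N -> (bdeg blk k al < B)%N.
  move=> km; rewrite ltnS -(bdeg_sum al blkm) (bigD1 (Ordinal km))//=.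
  exact: leq_addr.
have := @multinomial K K idfun m N B blk (fun=> 1) (fun k => bdeg blk k al) blkm degB.
have pE (be : N.-tuple nat) : \prod_(v < N) dpow idfun (tnth be v) 1 =
    \prod_(v < N) (tnth be v)`!%:R^-1.
  by apply: eq_bigr => v _; rewrite /dpow expr1n mulr1.
under eq_bigr do rewrite pE.
under [RHS]eq_bigr do rewrite sumr_const /dpow /=.
rewrite big_split /= => E.
rewrite /multicoef; set D := \prod_(k < m) _.
have D0 : 0 < D by rewrite prodr_gt0// => k _; rewrite ltr0n fact_gt0.
apply: (@le_trans _ _ (D * \sum_(be <- box N B | [forall k : 'I_m, bdeg blk k be == bdeg blk k al])
   \prod_(v < N) (tnth be v)`!%:R^-1)).
  apply: ler_wpM2l; first exact: ltW.
  rewrite [leRHS]big_mkcond [leRHS](bigD1_seq al) ?box_uniq//=; last first.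
    by rewrite mem_box; apply/forallP.
  rewrite ifT; last by apply/forallP => k.
  rewrite lerDl; apply: sumr_ge0 => be _; case: ifP => // _.
  by apply: prodr_ge0 => v _; rewrite invr_ge0 ler0n.
rewrite E prodfV -/D mulVKf ?gt_eqF// -(bdeg_sum al blkm) -prodrXr.
apply: ler_prod => k _; rewrite exprn_ge0 ?ler0n//=.
rewrite lerXn2r ?nnegrE ?ler0n// ler_nat -[leqRHS]card_ord.
exact: max_card.
Qed.

End MultiCoef.

Section Geometric.
Variable K : numFieldType.

Lemma half_sum_le B : \sum_(a < B) 2^-1 ^+ a <= 2 :> K.
Proof.
suff -> : \sum_(a < B) 2^-1 ^+ a = 2 - 2 * 2^-1 ^+ B :> K.
  by rewrite lerBlDr lerDl mulr_ge0// exprn_ge0// invr_ge0.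
elim: B => [|B IH]; first by rewrite big_ord0 expr0 mulr1 subrr.
rewrite big_ord_recr /= IH exprSr; field => //.
Qed.

(** Comparison with the multiple geometric series of ratio 1/2, whose sum over
    a box is a product of geometric sums. *)
Lemma abs_summable_geometric N (M : K) (F : N.-tuple nat -> K) :
  (forall al, `|F al| <= M * 2^-1 ^+ (\sum_(v < N) tnth al v)) ->
  abs_summable F.
Proof.
move=> FM; exists (M * 2 ^+ N) => X.
pose B := (\sum_(al <- X) \sum_(v < N) tnth al v).+1.
have XB al : al \in X -> al \in box N B.
  move=> alX; rewrite mem_box; apply/forallP => v.
  by rewrite ltnS (big_rem al)//= (bigD1 v)//= -addnA leq_addr.
have M0 : 0 <= M by have := FM [tuple 0%N | v < N]; rewrite big1 ?mulr1 => [/(le_trans _)|v _]; [exact|rewrite tnth_mktuple].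
apply: (@le_trans _ _ (\sum_(al <- box N B) M * 2^-1 ^+ (\sum_(v < N) tnth al v))).
  apply: (@le_trans _ _ (\sum_(al <- X) M * 2^-1 ^+ (\sum_(v < N) tnth al v))).
    exact: ler_sum.
  rewrite [leRHS](bigID (fun al => al \in X)) /= -[leLHS]addr0; apply: lerD.
    rewrite -[leRHS]big_filter le_eqVlt; apply/orP; left; apply/eqP/perm_big.
    apply: uniq_perm; [exact: fset_uniq | by rewrite filter_uniq ?box_uniq | ].
    by move=> al; rewrite mem_filter andb_idr//; exact: XB.
  by apply: sumr_ge0 => al _; rewrite mulr_ge0// exprn_ge0// invr_ge0.
rewrite -big_distrr ler_wpM2l//.
under eq_bigr do rewrite -prodrXr.
rewrite (sum_box_prod _ (fun v a => 2^-1 ^+ a : K)).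
apply: (@le_trans _ _ (\prod_(v < N) (2 : K))).
  by apply: ler_prod => v _; rewrite half_sum_le sumr_ge0// => a _; rewrite exprn_ge0// invr_ge0.
by rewrite prodr_const card_ord.
Qed.

End Geometric.

(** * Termwise differentiation *)

Section TermwiseDerivative.
Variable R : realType.
Local Notation K := (Cplx R).
Implicit Types T : choiceType.

Lemma leq_2exp a : (a <= 2 ^ a)%N.
Proof. exact: ltnW (ltn_expl _ _). Qed.

(** Induction on [a], writing the difference for [a.+1] as [h + z] times the
    difference for [a] plus a remainder. The factor [2 ^+ a] is a crude bound
    for the binomial coefficient of Taylor's formula. *)
Lemma exp_second_difference (r z h : K) a : 0 < r -> `|z| <= r -> `|h + z| <= r ->
  `|(h + z) ^+ a - z ^+ a - h * (a%:R * z ^+ a.-1)| <= `|h| ^+ 2 / r ^+ 2 * (2 * r) ^+ a.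
Proof.
move=> r0 zr hzr.
have X0 : 0 <= `|h| ^+ 2 / r ^+ 2 by rewrite divr_ge0// exprn_ge0// ltW.
elim: a => [|a IH].
  by rewrite !expr0 subrr sub0r mul0r mulr0 oppr0 normr0 mulr1.
have -> : (h + z) ^+ a.+1 - z ^+ a.+1 - h * (a.+1%:R * z ^+ a.+1.-1) =
    (h + z) * ((h + z) ^+ a - z ^+ a - h * (a%:R * z ^+ a.-1)) + h ^+ 2 * (a%:R * z ^+ a.-1).
  case: a {IH} => [|a] /=; first by rewrite !expr1 !expr0 !mul1r !mul0r !mulr0 !mulr1 !subr0 addrK !subrr mulr0 addr0.
  rewrite !exprS -!natr1; move: ((h + z) ^+ a) (z ^+ a) a%:R => u v w; ring.
apply: le_trans (ler_normD _ _) _.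
have -> : `|h| ^+ 2 / r ^+ 2 * (2 * r) ^+ a.+1 =
   r * (`|h| ^+ 2 / r ^+ 2 * (2 * r) ^+ a) + `|h| ^+ 2 / r ^+ 2 * (r * (2 * r) ^+ a).
  have aux (u v w : K) : u * (2 * w * v) = w * (u * v) + u * (w * v) by ring.
  by rewrite (exprS (2 * r)); exact: aux.
apply: lerD; first by rewrite normrM; apply: ler_pM.
rewrite normrM normrX -mulrA; apply: ler_wpM2l; first exact: exprn_ge0.
rewrite normrM normr_nat exprMn.
case: a {IH} => [|a]; first by rewrite mul0r mulr_ge0 ?mulr_ge0// ?invr_ge0 ?exprn_ge0// ltW.
have -> : (r ^+ 2)^-1 * (r * (2 ^+ a.+1 * r ^+ a.+1)) = 2 ^+ a.+1 * r ^+ a.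
  have aux (u v : K) : (r ^+ 2)^-1 * (r * (u * (r * v))) = u * v.
    by field; rewrite gt_eqF.
  by rewrite [r ^+ a.+1]exprS aux.
rewrite /= ler_pM ?ler0n//; first by rewrite -natrX ler_nat leq_2exp.
by rewrite normrX lerXn2r ?nnegrE// ltW.
Qed.

(** Halving the radius pays for the factor [e t], because [a <= 2 ^ a]. *)
Lemma abs_summable_derivative T (C : T -> K) (e : T -> nat) (s z : K) : 0 < s ->
  abs_summable (fun t => C t * s ^+ e t) -> `|z| <= s / 2 ->
  abs_summable (fun t => C t * ((e t)%:R * z ^+ (e t).-1)).
Proof.
move=> s0 Cs zs; have s20 : 0 < s / 2 by rewrite divr_gt0.
apply: (abs_summable_le (abs_summableZ (s / 2)^-1 Cs)) => t.
rewrite !normrM [leRHS]mulrCA; apply: ler_wpM2l => //.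
rewrite normr_nat !normrX (gtr0_norm s0) (@gtr0_norm _ (s / 2)^-1) ?invr_gt0//.
case: (e t) => [|a]; first by rewrite mul0r mulr1 invr_ge0 ltW.
have -> : s ^+ a.+1 = (s / 2) ^+ a.+1 * 2 ^+ a.+1 by rewrite -exprMn divfK.
rewrite /= mulrA.
have -> : (s / 2)^-1 * (s / 2) ^+ a.+1 = (s / 2) ^+ a by rewrite exprS mulKf// gt_eqF.
rewrite mulrC; apply: ler_pM => //.
  by rewrite lerXn2r ?nnegrE// ltW.
by rewrite -natrX ler_nat leq_2exp.
Qed.

(** By [exp_second_difference], the increment of [F] minus [h * d] is at most
    a constant times the square of [h]. An arbitrary index
    type with an exponent function is allowed: this covers one-variable series
    and multiple series in which all the variables but one are frozen. *)
Lemma termwise_derivative T (C : T -> K) (e : T -> nat) (s z : K) (F : K -> K) :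
  0 < s -> abs_summable (fun t => C t * s ^+ e t) ->
  (forall w, `|w| <= s / 2 -> has_sum (fun t => C t * w ^+ e t) (F w)) ->
  `|z| <= s / 4 ->
  exists2 d, has_sum (fun t => C t * ((e t)%:R * z ^+ (e t).-1)) d &
    h^-1 * (F (h + z) - F z) @[h --> 0^'] --> d.
Proof.
move=> s0 Cs FC zs; set r := s / 2.
have r0 : 0 < r by rewrite divr_gt0.
have s40 : 0 < s / 4 by rewrite divr_gt0.
have s4r : s / 4 + s / 4 = r by rewrite /r; field.
have zr : `|z| <= r by rewrite -s4r (le_trans zs)// lerDl ltW.
have [d Hd] := summable_has_sum (abs_summable_derivative s0 Cs zr).
exists d => //.
have [B HB] := Cs.
have B0 : 0 <= B by apply: le_trans (HB fset0); apply: sumr_ge0.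
have key h : `|h| <= s / 4 ->
    `|F (h + z) - F z - h * d| <= `|h| ^+ 2 / r ^+ 2 * B.
  move=> hs.
  have hzr : `|h + z| <= r by rewrite -s4r (le_trans (ler_normD _ _))// lerD.
  have := has_sumB (has_sumB (FC _ hzr) (FC _ zr)) (has_sumZ (k := h) Hd).
  move=> /has_sum_norm_le; apply => A.
  apply: le_trans (ler_norm_sum _ _ _) _.
  have X0 : 0 <= `|h| ^+ 2 / r ^+ 2 by rewrite divr_ge0// exprn_ge0// ltW.
  apply: le_trans (ler_wpM2l X0 (HB A)); rewrite big_distrr /=.
  apply: ler_sum => t _.
  have -> : C t * (h + z) ^+ e t - C t * z ^+ e t - h * (C t * ((e t)%:R * z ^+ (e t).-1)) =
     C t * ((h + z) ^+ e t - z ^+ e t - h * ((e t)%:R * z ^+ (e t).-1)) by ring.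
  rewrite !normrM [leRHS]mulrCA; apply: ler_wpM2l => //.
  apply: le_trans (exp_second_difference _ r0 zr hzr) _.
  rewrite normrX gtr0_norm//; have -> : 2 * r = s by rewrite /r; field.
  by [].
apply/cvgrPdist_le => eps eps0.
have B10 : 0 < B + 1 by rewrite ltr_wpDl.
have eps1 : 0 < eps * r ^+ 2 / (B + 1) by rewrite divr_gt0// mulr_gt0// exprn_gt0.
near=> h.
have h0 : h != 0 by near: h; exact: nbhs_dnbhs_neq.
have hs : `|h| <= s / 4 by near: h; apply: dnbhs0_le.
have he : `|h| <= eps * r ^+ 2 / (B + 1) by near: h; apply: dnbhs0_le.
have -> : d - h^-1 * (F (h + z) - F z) = - h^-1 * (F (h + z) - F z - h * d).
  by field.
rewrite normrM normrN normfV; apply: le_trans (ler_wpM2l _ (key h hs)) _.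
  by rewrite invr_ge0.
have -> : `|h|^-1 * (`|h| ^+ 2 / r ^+ 2 * B) = `|h| * (B / r ^+ 2).
  have aux (u v w : K) : u != 0 -> v != 0 -> u^-1 * (u ^+ 2 / v ^+ 2 * w) = u * (w / v ^+ 2).
    by move=> u0 v0; field; rewrite u0 v0.
  by apply: aux; rewrite ?normr_eq0// gt_eqF.
apply: le_trans (ler_wpM2r _ he) _; first by rewrite divr_ge0// exprn_ge0// ltW.
have -> : eps * r ^+ 2 / (B + 1) * (B / r ^+ 2) = eps * (B / (B + 1)).
  have r1 : r != 0 by rewrite gt_eqF.
  have B1 : B + 1 != 0 by rewrite gt_eqF.
  by field; rewrite r1 B1.
rewrite ler_piMr ?ltW// ltr_pdivrMr// mul1r ltrDl//.
Unshelve. all: by end_near.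
Qed.

(** A form of convergence that is stable under differentiation, at the price
    of a smaller radius. *)
Definition sums_on_disc T (C : T -> K) (e : T -> nat) (s : K) (F : K -> K) :=
  [/\ 0 < s, abs_summable (fun t => C t * s ^+ e t) &
      forall z, `|z| <= s -> has_sum (fun t => C t * z ^+ e t) (F z)].

Lemma sums_on_disc_derive1 T (C : T -> K) (e : T -> nat) s F :
  sums_on_disc C e s F ->
  sums_on_disc (fun t => C t * (e t)%:R) (fun t => (e t).-1) (s / 4) F^`()%classic.
Proof.
move=> [s0 Cs FC]; have s40 : 0 < s / 4 by rewrite divr_gt0.
split=> //.
  have zs : `|s / 4| <= s / 2.
    by rewrite gtr0_norm// ler_wpM2l ?(ltW s0)// lef_pV2 ?posrE// ler_nat.
  apply: abs_summable_le (abs_summable_derivative s0 Cs zs) _ => t.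
  by rewrite mulrA.
move=> z zs.
have [|d Hd Fd] := @termwise_derivative _ C e s z F s0 Cs _ zs.
  by move=> w ws; apply: FC; rewrite (le_trans ws)// ler_pdivrMr// ler_peMr ?ler1n// ltW.
rewrite /derive1; rewrite (_ : lim _ = d); first by apply: eq_has_sum Hd => t; rewrite mulrA.
exact: cvg_lim.
Qed.

(** After [j] differentiations, only the terms of exponent [j] survive at 0. *)
Lemma derive1n_has_sum T (C : T -> K) (e : T -> nat) s F j :
  sums_on_disc C e s F ->
  has_sum (fun t => if e t == j then j`!%:R * C t else 0) (derive1n j F 0).
Proof.
move=> H.
have [s' [s'0 _ H']] : exists s', sums_on_disc (fun t => C t * (e t ^_ j)%:R)
   (fun t => (e t - j)%N) s' (derive1n j F).
  elim: j => [|j [s' IH]].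
    exists s; congr (sums_on_disc _ _ _ _) : H; apply/funext => t.
      by rewrite ffactn0 mulr1.
    by rewrite subn0.
  exists (s' / 4); rewrite derive1nS; congr (sums_on_disc _ _ _ _) : (sums_on_disc_derive1 IH).
    by apply/funext => t; rewrite -mulrA -natrM ffactnSr.
  by apply/funext => t; rewrite subnS.
have H0 := H' 0; rewrite normr0 in H0; apply: eq_has_sum (H0 (ltW s'0)) => t.
case: eqP => [->|/eqP]; first by rewrite subnn expr0 ffactnn mulr1 mulrC.
rewrite neq_ltn => /orP[ej|je]; first by rewrite ffact_small// mulr0 mul0r.
by rewrite expr0n subn_eq0 leqNgt je mulr0.
Qed.

End TermwiseDerivative.

(** * Power series in several variables *)

Section MultiIndices.
Variable N : nat.
Implicit Types (I : N.-tuple nat) (k v : 'I_N).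

Definition incr k I : N.-tuple nat := [tuple (tnth I v + (v == k))%N | v < N].
Definition decr k I : N.-tuple nat := [tuple (tnth I v - (v == k))%N | v < N].
Definition msize I : nat := \sum_(v < N) tnth I v.
Definition zero_idx : N.-tuple nat := [tuple 0%N | v < N].

Lemma tnth_incr k I v : tnth (incr k I) v = (tnth I v + (v == k))%N.
Proof. by rewrite tnth_mktuple. Qed.

Lemma incrK k I : decr k (incr k I) = I.
Proof. by apply: eq_from_tnth => v; rewrite !tnth_mktuple addnK. Qed.

Lemma decrK k I : tnth I k != 0%N -> incr k (decr k I) = I.
Proof.
move=> Ik; apply: eq_from_tnth => v; rewrite !tnth_mktuple subnK//.
by case: eqP => // ->; rewrite lt0n.
Qed.

Lemma msize_incr k I : msize (incr k I) = (msize I).+1.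
Proof.
rewrite /msize (bigD1 k)//= [in RHS](bigD1 k)//= tnth_incr eqxx addn1 addSn.
by congr (_ + _).+1; apply: eq_bigr => v /negbTE vk; rewrite tnth_incr vk addn0.
Qed.

Lemma msize_eq0 I : msize I = 0%N -> I = zero_idx.
Proof.
move=> /eqP; rewrite sum_nat_eq0 => /forallP I0; apply: eq_from_tnth => v.
by rewrite tnth_mktuple; apply/eqP; exact: I0.
Qed.

Lemma msize_neq0 I : I != zero_idx -> exists k, tnth I k != 0%N.
Proof.
move=> I0; apply/existsP; apply: contraNT I0; rewrite negb_exists => /forallP H.
apply/eqP/msize_eq0/eqP; rewrite sum_nat_eq0; apply/forallP => v.
by have := H v; rewrite negbK.
Qed.

Lemma monomial_prod (K : numFieldType) (x : 'rV[K]_N) k I : monomial x I =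
  x 0 k ^+ tnth I k * \prod_(v < N | v != k) x 0 v ^+ tnth I v.
Proof. by rewrite /monomial (bigD1 k). Qed.

End MultiIndices.

Section PowerSeries.
Variables (R : realType) (N : nat).
Local Notation K := (Cplx R).
Implicit Types (c : N.-tuple nat -> K) (f : 'rV[K]_N -> K) (p x : 'rV[K]_N).

Lemma has_sum_bounded (T : choiceType) (F : T -> K) l : has_sum F l ->
  exists2 M : K, 0 <= M & forall t, `|F t| <= M.
Proof.
move=> /has_sumP/(_ _ ltr01)[A HA].
exists (2 + \sum_(t <- A) `|F t|) => [|t]; first by rewrite addr_ge0// sumr_ge0.
case: (boolP (t \in A)) => tA.
  by rewrite (big_rem t)//= addrCA lerDl addr_ge0// sumr_ge0.
have := HA (t |` A)%fset (fsubsetU1 _ _); have := HA A (fsubset_refl _).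
rewrite big_fsetU1//=; set S := \sum_(t <- A) F t => h1 h2.
apply: (@le_trans _ _ 2); last by rewrite lerDl sumr_ge0.
have -> : F t = (l - S) - (l - (F t + S)) by ring.
rewrite (le_trans (ler_normB _ _))// (_ : 2 = 1 + 1)//.
by rewrite lerD// ltW.
Qed.

Lemma near_polydisc p (P : set 'rV[K]_N) :
  (\forall x \near p, P x) <->
  exists2 r : K, 0 < r & forall x, (forall v, `|(x - p) 0 v| <= r) -> P x.
Proof.
split.
  move=> /nbhs_ballP[e /= e0 He]; have e20 : 0 < e / 2 by rewrite divr_gt0.
  exists (e / 2) => // x xr; apply: He; split => // i j; rewrite (ord1 i).
  rewrite -ball_normE /ball_ /= distrC.
  apply: (@le_lt_trans _ _ (e / 2)); first by have := xr j; rewrite !mxE.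
  by rewrite ltr_pdivrMr// ltr_pMr// (ltr_nat K 1 2).
move=> [r r0 Hr]; apply/nbhs_ballP; exists r => //= x [_ xr]; apply: Hr => v.
by have := xr 0 v; rewrite -ball_normE /ball_ /= distrC !mxE => /ltW.
Qed.

(** On a polydisc of half the radius the terms are dominated by a multiple
    geometric series. *)
Lemma abs_summable_monomial c M r (y : 'rV[K]_N) : 0 < r ->
  (forall I, `|c I| * r ^+ msize I <= M) -> (forall v, `|y 0 v| <= r / 2) ->
  abs_summable (fun I => c I * monomial y I).
Proof.
move=> r0 cM yr; apply: (@abs_summable_geometric _ _ M) => I.
rewrite normrM; apply: (@le_trans _ _ (`|c I| * (r / 2) ^+ msize I)).
  apply: ler_wpM2l => //; rewrite /monomial normr_prod /msize -prodrXr.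
  apply: ler_prod => v _; rewrite normr_ge0 /= normrX lerXn2r ?nnegrE//.
  exact: le_trans (yr v).
by rewrite exprMn mulrA; apply: ler_wpM2r => //; rewrite exprn_ge0// invr_ge0.
Qed.

(** The terms of a convergent series are bounded. At a point all of whose
    coordinates are at distance [r] from the centre, this bounds the coefficients
    geometrically. *)
Lemma power_series_bound c f p : has_power_series c f p ->
  exists r M : K, [/\ 0 < r, forall I, `|c I| * r ^+ msize I <= M &
    forall x, (forall v, `|(x - p) 0 v| <= r) ->
      has_sum (fun I => c I * monomial (x - p) I) (f x)].
Proof.
move=> /near_polydisc[r r0 Hr].
have [|M M0 HM] := has_sum_bounded (Hr (p + const_mx r) _).
  by move=> v; rewrite addrC addKr mxE gtr0_norm.
exists r, M; split => // I; have := HM I.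
rewrite addrC addKr normrM /monomial normr_prod; congr (_ * _ <= _).
by rewrite /msize -prodrXr; apply: eq_bigr => v _; rewrite mxE normrX gtr0_norm.
Qed.

(** Coefficients of the partial derivative of a power series. *)
Definition dcoef k c : N.-tuple nat -> K := fun I => (tnth I k).+1%:R * c (incr k I).

(** With all the coordinates but the [k]-th frozen, [f] is a series in one
    variable with exponents [tnth I k], to which [termwise_derivative] applies;
    shifting the multi-indices by one in position [k] gives back a power series. *)
Lemma power_series_derivative c f p k : has_power_series c f p ->
  has_power_series (dcoef k c) (fun x => 'D_(delta_mx 0 k) f x) p.
Proof.
move=> /power_series_bound[r [M [r0 cM Hf]]].
(* The series converges absolutely on the polydisc of radius [r / 2], a quarter
   of which is left for the termwise derivative. *)
apply/near_polydisc; exists (r / 8); first by rewrite divr_gt0.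
move=> x xp; pose y := x - p.
pose C (I : N.-tuple nat) := c I * \prod_(v < N | v != k) y 0 v ^+ tnth I v.
(* [X w] is [x] with its [k]-th coordinate, counted from [p], replaced by [w]. *)
pose X (w : K) : 'rV[K]_N := x + (w - y 0 k) *: delta_mx 0 k.
have Xv w v : (X w - p) 0 v = if v == k then w else y 0 v.
  rewrite /X /y !mxE eqxx /=; case: (v =P k) => [->|_]; rewrite ?mulr1 ?mulr0; ring.
have s0 : 0 < r / 2 by rewrite divr_gt0.
have yr2 v : `|y 0 v| <= r / 2.
  by rewrite (le_trans (xp v))// ler_wpM2l ?(ltW r0)// lef_pV2 ?posrE// ler_nat.
have half_le (u : K) : 0 < u -> u / 2 <= u.
  by move=> u0; rewrite ler_pdivrMr// ler_peMr ?ler1n// ltW.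
have Cmono w I : C I * w ^+ tnth I k = c I * monomial (X w - p) I.
  rewrite (monomial_prod _ k) Xv eqxx /C -mulrA [X in _ * X]mulrC; congr (_ * (_ * _)).
  by apply: eq_bigr => v /negbTE vk; rewrite Xv vk.
have Cs : abs_summable (fun I => C I * (r / 2) ^+ tnth I k).
  under [X in abs_summable X]eq_fun do rewrite Cmono.
  apply: (abs_summable_monomial r0 cM) => v; rewrite Xv; case: ifP => _ //.
  by rewrite gtr0_norm.
have [||d Hd Dd] := @termwise_derivative _ _ C (fun I => tnth I k) (r / 2) (y 0 k) (f \o X) s0 Cs.
- move=> w ws; apply: eq_has_sum (Hf (X w) _) => [I|v]; first by rewrite Cmono.
  rewrite Xv; case: ifP => _; [apply: (le_trans ws)|apply: (le_trans (yr2 v))].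
    exact: le_trans (half_le _ s0) (half_le _ r0).
  exact: half_le.
- by apply: le_trans (xp k) _; rewrite -mulrA -invfM -natrM.
have -> : 'D_(delta_mx 0 k) f x = d.
  rewrite /derive (_ : (fun h => _) =
    fun h : K => h^-1 * ((f \o X) (h + y 0 k) - (f \o X) (y 0 k))).
    exact: cvg_lim Dd.
  apply/funext => h /=; rewrite /X addrK subrr scale0r addr0.
  by rewrite [x + _]addrC.
have yk : `|y 0 k| <= r / 2 / 2.
  by rewrite (le_trans (xp k))// -mulrA -invfM -natrM ler_wpM2l ?(ltW r0)// lef_pV2 ?posrE// ler_nat.
have Fs := abs_summable_derivative s0 Cs yk.
apply: (@has_sum_finite_fibers _ _ _ (decr k) (fun J => [:: incr k J])
  _ (fun J => dcoef k c J * monomial y J) _ _ Hd).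
- exact: Fs.
- by [].
- move=> I; rewrite inE => nz; rewrite decrK//; apply: contraNneq nz => ->.
  by rewrite mul0r mulr0.
move=> J; rewrite big_mkcond big_seq1 incrK eqxx tnth_incr eqxx addn1 /=.
rewrite /dcoef /C (monomial_prod _ k) -/y mulrCA -!mulrA; congr (_ * (_ * _)).
rewrite mulrC; congr (_ * _).
by apply: eq_bigr => v /negbTE vk; rewrite tnth_incr vk addn0.
Qed.

Lemma power_series_center c f p : has_power_series c f p -> f p = c (@zero_idx N).
Proof.
move=> /power_series_bound[r [M [r0 _ Hf]]].
have H : has_sum (fun I => c I * monomial (p - p) I) (f p).
  by apply: Hf => v; rewrite subrr mxE normr0 ltW.
rewrite (has_sum_unique H (has_sum_seq (s := [:: @zero_idx N]) _ _))//.
  rewrite big_seq1 /monomial big1 ?mulr1// => v _; rewrite tnth_mktuple//.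
move=> I; rewrite inE => /msize_neq0[k Ik].
by rewrite (monomial_prod _ k) subrr mxE expr0n (negbTE Ik) mul0r mulr0.
Qed.

(** Induction on the degree: a coefficient of degree 0 is the value at the
    centre, and one of positive degree is, up to a nonzero factor, a coefficient
    of lower degree of a derivative, which is again zero. *)
Lemma power_series_eq0 c p : has_power_series c (fun=> 0) p -> forall I, c I = 0.
Proof.
move=> c0 I; have [n nI] : exists n, msize I = n by exists (msize I).
elim: n c c0 I nI => [|n IH] c c0 I nI.
  by rewrite (msize_eq0 nI) -(power_series_center c0).
have [k Ik] : exists k, tnth I k != 0%N.
  by apply: msize_neq0; apply/eqP => I0; move: nI; rewrite I0 /msize big1// => v _; rewrite tnth_mktuple.
have := power_series_derivative k c0.
rewrite (_ : (fun x => _) = fun=> 0); last first.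
  by apply/funext => x; exact: derive_cst.
move=> /IH/(_ (decr k I)) H.
have /H : msize (decr k I) = n by apply: succn_inj; rewrite -nI -(msize_incr k) decrK.
rewrite /dcoef decrK// => /eqP; rewrite mulf_eq0 pnatr_eq0 /=.
by move/eqP.
Qed.

Lemma power_series_unique c c' f f' p : has_power_series c f p ->
  has_power_series c' f' p -> (\forall x \near p, f x = f' x) -> c =1 c'.
Proof.
move=> cf cf' ff' I; apply/eqP; rewrite -subr_eq0; apply/eqP.
apply: (@power_series_eq0 (fun I => c I - c' I) p).
apply: filterS3 ff' cf cf' => x ff'x fx fx'.
rewrite -(subrr (f x)) {2}ff'x; apply: eq_has_sum (has_sumB fx fx') => J.
by rewrite mulrBl.
Qed.

End PowerSeries.

(** * Variables, blocks and star powers *)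

Section BlockAlgebra.
Variables (K : numFieldType) (m : nat) (n : nat -> nat).
Local Notation N := (nvars m n).
Implicit Types (v u : 'I_N) (x : 'rV[K]_N).

(** The variable [v] is the coordinate of index [wt v] in the block [blk v], and
    [vnext v] is the next coordinate of this block. The index is called weight:
    in [x^k_mu] the variable [v] comes with [mu ^ (wt v)]. *)
Definition vblk v : 'I_m := @tagnat.sig1 m (fun k : 'I_m => (n k).+1) v.
Definition blk v : nat := vblk v.
Definition wt v : nat := @tagnat.sig2 m (fun k : 'I_m => (n k).+1) v.
Definition var (k : 'I_m) (i : nat) : 'I_N :=
  @tagnat.Rank m (fun k : 'I_m => (n k).+1) k (inord i).
Definition vnext v : 'I_N := var (vblk v) (wt v).+1.

Lemma blk_lt v : (blk v < m)%N. Proof. exact: ltn_ord. Qed.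

Lemma wt_le v : (wt v <= n (blk v))%N.
Proof. by rewrite -ltnS; exact: ltn_ord. Qed.

Lemma vblk_var k i : vblk (var k i) = k.
Proof. exact: tagnat.Rank1K. Qed.

Lemma blk_var (k : 'I_m) i : blk (var k i) = k.
Proof. by rewrite /blk vblk_var. Qed.

Lemma wt_Rank (k : 'I_m) (i : 'I_(n k).+1) :
  wt (@tagnat.Rank m (fun k : 'I_m => (n k).+1) k i) = i.
Proof.
rewrite /wt tagnat.Rank2K.
by case: _ / (esym (tagnat.Rank1K i)).
Qed.

Lemma wt_var (k : 'I_m) i : (i <= n k)%N -> wt (var k i) = i.
Proof. by move=> ik; rewrite /var wt_Rank inordK. Qed.

Lemma varE v : var (vblk v) (wt v) = v.
Proof. by rewrite /var /wt inord_val tagnat.sig2K. Qed.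

Lemma var_inj v u : blk v = blk u -> wt v = wt u -> v = u.
Proof. by move=> /val_inj E1 E2; rewrite -[LHS]varE -[RHS]varE E1 E2. Qed.

Lemma blk_vnext v : blk (vnext v) = blk v.
Proof. by rewrite blk_var. Qed.

Lemma wt_vnext v : (wt v < n (blk v))%N -> wt (vnext v) = (wt v).+1.
Proof. by move=> h; rewrite wt_var. Qed.

Lemma Umx_entry u v :
  Umx K m n u v = ((blk u == blk v) && (wt v == (wt u).+1))%:R.
Proof.
rewrite /Umx /mxdiag !mxE /blk /wt /vblk.
move: (tagnat.sig1 u) (tagnat.sig2 u) (tagnat.sig1 v) (tagnat.sig2 v) => i a j b.
case: (eqVneq i j) => [E|ij]; last by rewrite (negbTE (ij : val i != val j)) mxE.
by subst j; rewrite conform_mx_id mxE eqxx.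
Qed.

(** Stated over a ring [A] over [K], because [U] acts on gradients of functions
    as well as on gradients with polynomial entries. *)
Lemma Umx_mul (A : nzRingType) (f : {rmorphism K -> A}) (w : 'cV[A]_N) v :
  (map_mx f (Umx K m n) *m w) v 0 =
  if (wt v < n (blk v))%N then w (vnext v) 0 else 0.
Proof.
rewrite mxE; under eq_bigr do rewrite mxE Umx_entry rmorph_nat.
case: ltnP => h.
  rewrite (bigD1 (vnext v))//= blk_vnext wt_vnext// !eqxx mul1r big1 ?addr0// => u.
  case: (blk v =P blk u) => [E|]; last by rewrite mul0r.
  case: (wt u =P (wt v).+1) => [E'|]; last by rewrite mul0r.
  by case/eqP; apply: var_inj; rewrite ?blk_vnext ?wt_vnext.
rewrite big1// => u _; case: (blk v =P blk u) => [E|]; last by rewrite mul0r.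
case: (wt u =P (wt v).+1) => [E'|]; last by rewrite mul0r.
by have := wt_le u; rewrite E' -E ltnNge h.
Qed.

Lemma coef_xpol x (k : 'I_m) i :
  (xpol x k)`_i = if (i <= n k)%N then x 0 (var k i) else 0.
Proof.
rewrite /xpol valK coef_rVpoly; case: insubP => [j jn <-|].
  by rewrite -ltnS ltn_ord mxE /var inord_val.
by rewrite ltnS => /negbTE ->.
Qed.

Lemma xpol_size x k : (size (xpol x k) <= (n k).+1)%N.
Proof.
rewrite /xpol; case: insubP => [k' _ <-|_]; last by rewrite size_poly0.
by rewrite /rVpoly; exact: size_poly.
Qed.

Lemma xpol_sum x (k : 'I_m) :
  xpol x k = \sum_(v < N | blk v == k) (x 0 v)%:P * 'X^(wt v).
Proof.
apply/polyP => i; rewrite coef_xpol coef_sum; under eq_bigr do rewrite coefCM coefXn.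
case: leqP => ik.
  rewrite (bigD1 (var k i)) ?blk_var//= wt_var// eqxx mulr1 big1 ?addr0// => u.
  move=> /andP[/eqP uk uv]; case: (i =P wt u) => [E|]; last by rewrite mulr0.
  by case/eqP: uv; apply: var_inj; rewrite ?blk_var ?wt_var.
rewrite big1// => u /eqP uk; case: (i =P wt u) => [E|]; last by rewrite mulr0.
by have := wt_le u; rewrite uk -E leqNgt ik.
Qed.

End BlockAlgebra.

Section StarPowers.
Variables (K : numFieldType) (m : nat) (n : nat -> nat).
Hypothesis hn : forall i j : nat, (i <= j)%N -> (j < m)%N -> (n j <= n i)%N.

Lemma coef_modXn (p : {poly K}) d i :
  (p %% 'X^d)`_i = if (i < d)%N then p`_i else 0.
Proof. by rewrite -Pdiv.IdomainMonic.take_poly_modp coef_take_poly. Qed.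

(** Multiplication by [mu ^ (n s - n s.+1)] turns congruences modulo
    [mu ^ (n s.+1).+1] into congruences modulo [mu ^ (n s).+1], so that all the
    reductions may be postponed to the last one. *)
Lemma coef_starpow (y : nat -> {poly K}) (I : seq nat) s i :
  (0 < size I)%N -> (s + size I <= m)%N -> (i <= n s)%N ->
  (starpow n s y I)`_i =
  ('X^(n s - n (s + size I).-1) * \prod_(k < size I) y (s + k)%N ^+ nth 0%N I k)`_i.
Proof.
elim: I s i => // a [|b I] IH s i _ sm im.
  by rewrite /= coef_modXn ltnS im addn1 subnn expr0 mul1r big_ord1 addn0.
set J := b :: I in IH *; set Q := starpow n s.+1 y J.
have -> : starpow n s y (a :: J) =
  (y s ^+ a * 'X^(n s - n s.+1) * Q) %% 'X^((n s).+1) by [].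
have sJm : (s.+1 + size J <= m)%N by rewrite addSnnS.
have n1 : (n s.+1 <= n s)%N by apply: hn => //; apply: leq_trans sJm; rewrite addnS ltnS leq_addr.
have n2 : (n (s + size (a :: J)).-1 <= n s.+1)%N.
  apply: hn; rewrite /= !addnS ?ltnS ?leq_addr//; by move: sm; rewrite /= !addnS.
have nE : (n s - n (s + size (a :: J)).-1 =
    (n s - n s.+1) + (n s.+1 - n (s.+1 + size J).-1))%N.
  by rewrite addSnnS addnBA// subnK.
rewrite coef_modXn ltnS im [y s ^+ a * _]mulrC -mulrA coefXnM.
rewrite nE exprD -[in RHS]mulrA [RHS]coefXnM; case: ltnP => // mi.
rewrite big_ord_recl /= addn0 [in RHS]mulrCA !coefM.
apply: eq_bigr => j _; congr (_ * _).
rewrite IH//; last by rewrite (leq_trans (leq_subr _ _))// leq_subLR subnK.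
congr (nth 0 (polyseq (_ * _)) _); apply: eq_bigr => k _.
by rewrite addSnnS.
Qed.

Lemma coef_star_gt (p q : {poly K}) s i : (n s < i)%N -> (star n s p q)`_i = 0.
Proof. by move=> h; rewrite /star coef_modXn ltnNge h. Qed.

(** By [coef_starpow], the term of superscript [j] of [b_I] enters with
    [mu ^ (n 0 - j)] times the ordinary product of powers. So the coefficient of
    [mu ^ (n 0 - s)] picks the coefficient of [mu ^ (j - s)] in this product. *)
Lemma coef_star_bpol (c : seq nat -> nat -> K) r (I : seq nat) (y : nat -> {poly K}) l :
  (r < m)%N -> size I = r.+1 -> (l <= n 0)%N ->
  (star n 0 (bpol m n c r I) (starpow n 0 y I))`_l =
  \sum_(next_lower m n r <= j < (n r).+1)
    (if (n 0 - l <= j)%N then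
       j`!%:R * c I j * (\prod_(k < r.+1) y k ^+ nth 0%N I k)`_(j - (n 0 - l)) else 0).
Proof.
move=> rm sI ln; rewrite /star coef_modXn ltnS ln.
set P := \prod_(k < r.+1) _.
have nr : (n r <= n 0)%N by apply: hn.
have -> : (bpol m n c r I * starpow n 0 y I)`_l =
    (bpol m n c r I * ('X^(n 0 - n r) * P))`_l.
  rewrite !coefM; apply: eq_bigr => i _; congr (_ * _).
  by rewrite coef_starpow ?sI// (leq_trans (leq_subr _ _)).
rewrite /bpol big_distrl coef_sum !big_nat; apply: eq_bigr => j /andP[_ jr].
rewrite /= -scalerAl coefZ mulrA -exprD coefXnM.
have -> : (n r - j + (n 0 - n r))%N = (n 0 - j)%N.
  by rewrite addnC addnBA// subnK.
have jn : (j <= n 0)%N by apply: leq_trans nr.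
have -> : (n 0 - l <= j)%N = ~~ (l < n 0 - j)%N by rewrite -leqNgt !leq_subLR addnC.
case: ltnP => h /=; first by rewrite mulr0.
congr (_ * nth 0 (polyseq _) _); lia.
Qed.

End StarPowers.

(** * Superscripts, constant solutions and simple solutions *)

Section Nu.
Variables (m : nat) (n : nat -> nat).
Hypothesis hn : forall i j : nat, (i <= j)%N -> (j < m)%N -> (n j <= n i)%N.

Lemma lt_nu i j : (i < m)%N -> (i < nu m n j)%N = (j <= n i)%N.
Proof.
move=> im; apply/idP/idP => h; last first.
  exact: (@leq_bigmax_cond _ (fun i : 'I_m => (j <= n i)%N) (fun i => i.+1) (Ordinal im)).
rewrite leqNgt; apply/negP => nj; move: h; rewrite ltnNge => /negP; apply.
apply/bigmax_leqP => k jk; rewrite ltnNge; apply/negP => ik.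
by have := leq_ltn_trans (leq_trans jk (hn ik (ltn_ord k))) nj; rewrite ltnn.
Qed.

Lemma nu_le j : (nu m n j <= m)%N.
Proof. by apply/bigmax_leqP => k _; exact: ltn_ord. Qed.

Lemma nu_range r j : (r < m)%N ->
  (next_lower m n r <= j < (n r).+1)%N = (nu m n j == r.+1).
Proof.
move=> rm; rewrite ltnS -(lt_nu _ rm) eqn_leq; congr andb.
rewrite /next_lower; case: ltnP => r1m; first by rewrite ltnNge -(lt_nu _ r1m) -leqNgt.
by rewrite leq0n (leq_trans (nu_le j)).
Qed.

Lemma nu_gt0 j : (0 < m)%N -> (j <= n 0)%N -> (0 < nu m n j)%N.
Proof. by move=> m0; rewrite lt_nu. Qed.

(** The intervals of superscripts attached to the blocks partition the
    superscripts up to [n 0]. *)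
Lemma sum_nu_ranges (V : nmodType) (F : nat -> nat -> V) : (0 < m)%N ->
  \sum_(r < m) \sum_(next_lower m n r <= j < (n r).+1) F r j =
  \sum_(j < (n 0).+1) F (nu m n j).-1 j.
Proof.
move=> m0.
have rE (r : 'I_m) : \sum_(next_lower m n r <= j < (n r).+1) F r j =
    \sum_(j < (n 0).+1 | nu m n j == r.+1) F r j.
  rewrite (big_nat_widenl _ 0)// (big_nat_widen _ _ (n 0).+1) ?ltnS ?hn//.
  by rewrite big_mkord; apply: eq_bigl => j; rewrite /= nu_range.
under eq_bigr do rewrite rE.
rewrite (exchange_big_dep xpredT)//=; apply: eq_bigr => j _.
have j0 : (0 < nu m n j)%N by apply: nu_gt0 => //; rewrite -ltnS.
have rm : ((nu m n j).-1 < m)%N by rewrite prednK// nu_le.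
rewrite (big_pred1 (Ordinal rm))//= => r.
by rewrite -{1}(prednK j0) eqSS eq_sym.
Qed.

End Nu.

Section Solutions.
Variables (K : numFieldType) (m : nat) (n : nat -> nat).
Local Notation N := (nvars m n).
Implicit Types (x p : 'rV[K]_N).

Lemma derive_coord x (u v : 'I_N) :
  'D_(delta_mx 0 v) (fun z : 'rV[K]_N => z 0 u) x = (u == v)%:R.
Proof.
rewrite /derive; apply: cvg_lim => //; apply: cvg_near_cst; near=> h.
have h0 : h != 0 by near: h; exact: nbhs_dnbhs_neq.
by rewrite /= !mxE eqxx addrK /GRing.scale /= mulKf.
Unshelve. all: by end_near.
Qed.

Lemma has_power_series_cst N' (a : K) (p : 'rV[K]_N') :
  has_power_series (fun I => if I == zero_idx N' then a else 0) (fun=> a) p.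
Proof.
apply: filterE => x.
have := @has_sum_seq K _ (fun I => (if I == zero_idx N' then a else 0) * monomial (x - p) I)
  [:: zero_idx N'] isT.
rewrite big_seq1 eqxx /monomial big1 ?mulr1 => [|v _]; last by rewrite tnth_mktuple.
by apply => I; rewrite inE => /negbTE ->; rewrite mul0r.
Qed.

Lemma analytic_coord (u : 'I_N) : analytic_on setT (fun z : 'rV[K]_N => z 0 u).
Proof.
move=> p _; pose e := incr u (zero_idx N).
have ez : e != zero_idx N.
  apply/eqP => /(congr1 (fun I => tnth I u)).
  by rewrite tnth_incr !tnth_mktuple eqxx.
exists (fun I => if I == zero_idx N then p 0 u else (I == e)%:R).
apply: filterE => x.
have := @has_sum_seq K _ (fun I => (if I == zero_idx N then p 0 u else (I == e)%:R) * monomial (x - p) I)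
  [:: zero_idx N; e].
rewrite big_cons big_seq1 eqxx (negbTE ez) eqxx.
have -> : monomial (x - p) (zero_idx N) = 1.
  by rewrite /monomial big1// => v _; rewrite tnth_mktuple.
have -> : monomial (x - p) e = x 0 u - p 0 u.
  rewrite (monomial_prod _ u) big1 => [|v /negbTE vu]; last first.
    by rewrite tnth_incr tnth_mktuple vu.
  by rewrite tnth_incr tnth_mktuple eqxx add0n expr1 mulr1 !mxE.
rewrite mulr1 mul1r [p 0 u + _]addrC subrK.
apply; first by rewrite /= inE eq_sym ez.
move=> I; rewrite !inE negb_or => /andP[/negbTE -> /negbTE ->].
by rewrite mul0r.
Qed.

(** The gradient of a constant vanishes, so the degree is the only condition. *)
Lemma constant_solutionP (b : {poly K}) : (size b <= (n 0).+1)%N ->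
  constant_solution m n 0 b.
Proof.
move=> sb; split => //.
  move=> k p _; eexists; exact: has_power_series_cst.
move=> x k i _; rewrite (_ : gradpoly _ _ _ = 0) ?mulmx0 ?mxE ?dvdp0//.
apply/matrixP => v j; rewrite !mxE; apply/polyP => l; rewrite coef_poly coef0.
by case: ifP => // _; rewrite mxE derive_cst.
Qed.

Lemma bpol_constant_solution (c : seq nat -> nat -> K) r I :
  (forall i j : nat, (i <= j)%N -> (j < m)%N -> (n j <= n i)%N) -> (r < m)%N ->
  constant_solution m n 0 (bpol m n c r I).
Proof.
move=> hn rm; apply: constant_solutionP.
apply: (leq_trans (size_sum _ _ _)); apply/bigmax_leqP_seq => j _ _.
apply: (leq_trans (size_scale_leq _ _)); rewrite size_polyXn ltnS.
by rewrite (leq_trans (leq_subr _ _))// hn.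
Qed.

(** In block [s] the gradient of [x^s_mu] is the column of the powers of [mu],
    which multiplication by [mu] and application of [U] both shift by one place;
    they differ in the last place only, by [mu ^ (n s).+1]. *)
Lemma xpol_simple_solution s : (s < m)%N ->
  simple_solution s (fun x => xpol (n := n) x s : {poly K}).
Proof.
move=> sm; pose s' := Ordinal sm.
have cE x i : (xpol x s)`_i = if (i <= n s)%N then x 0 (var n s' i) else 0.
  by rewrite (coef_xpol x s').
split; last first.
  move=> k a x y; rewrite !cE; case: ifP => _; first by rewrite !mxE.
  by rewrite mulr0 addr0.
split.
- by move=> x; exact: xpol_size.
- move=> k; rewrite (_ : (fun x => _) = fun x => if (k <= n s)%N then x 0 (var n s' k) else 0).
    case: (k <= n s)%N; first exact: analytic_coord.
    by move=> p _; eexists; exact: has_power_series_cst.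
  by apply/funext => x.
- move=> x x' H; rewrite /xpol; case: insubP => [k _ ks|//].
  by rewrite H// ks.
move=> x k i sk; set v := tagnat.Rank k i.
have gE u : gradpoly (n s) (fun x => xpol x s) x u 0 = if blk u == s then 'X^(wt u) else 0.
  rewrite mxE; apply/polyP => l; rewrite coef_poly mxE.
  rewrite (_ : (fun x => _) = fun x => if (l <= n s)%N then x 0 (var n s' l) else 0); last first.
    by apply/funext => z; rewrite cE.
  rewrite ltnS; case: (leqP l (n s)) => ls; last first.
    case: eqP => [E|]; rewrite ?coef0// coefXn; case: eqP => // lE.
    by have := wt_le u; rewrite E -lE leqNgt ls.
  rewrite derive_coord; case: (blk u =P s) => [E|E].
    rewrite coefXn; case: (var n s' l =P u) => [<-|F]; first by rewrite wt_var// eqxx.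
    by case: (l =P wt u) => // lE; case: F; apply: var_inj; rewrite ?blk_var ?wt_var.
  by rewrite coef0; case: eqP => // F; case: E; rewrite -F blk_var.
rewrite mulmxDl mulNmx mul_scalar_mx mxE [X in X + _]mxE [X in _ + X]mxE.
rewrite Umx_mul !gE blk_vnext; case: (blk v =P s) => [E|]; last first.
  by rewrite if_same oppr0 mulr0 add0r dvdp0.
case: ltnP => h; first by rewrite wt_vnext// -exprS addNr dvdp0.
rewrite oppr0 add0r -exprS; have -> : wt v = n s; last exact: dvdpp.
by apply/eqP; rewrite eqn_leq -{1}E wt_le -E.
Qed.

End Solutions.

(** * Regrouping a power series by block degrees *)

Section Coefficients.
Variables (R : realType) (m : nat) (n : nat -> nat).
Local Notation K := (Cplx R).
Local Notation N := (nvars m n).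
Local Notation blk := (@blk m n).
Local Notation wt := (@wt m n).
Implicit Types (x : 'rV[K]_N) (al : N.-tuple nat) (c : seq nat -> nat -> K).

(** The exponent of [mu] that accompanies the monomial [al] in a product of
    powers of the [x^k_mu]. *)
Definition wsum al : nat := \sum_(v < N) tnth al v * wt v.

Definition degs r al : r.-tuple nat := [tuple bdeg blk k al | k < r].

Definition supp r al : bool := [forall v, (tnth al v != 0%N) ==> (blk v < r)%N].

(** The coefficient of the monomial [al] in the expansion of [phi_j (x_mu)],
    where it comes with [mu ^ wsum al]. *)
Definition block_coef c j al : K :=
  if supp (nu m n j) al then c (degs (nu m n j) al) j * multicoef K m blk al else 0.

(** The coefficient of the monomial [al] in [j!] times the coefficient of
    [mu ^ (j - s)] in [phi_j (x_mu)]. *)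
Definition weight_coef c j s al : K :=
  if (wsum al + s)%N == j then j`!%:R * block_coef c j al else 0.

(** Power series coefficients of the coefficient of [mu ^ (n 0 - s)] in the sum
    of the star series: [s = 0] gives [g], and [s = 1] gives [h]. *)
Definition star_coef c s al : K := \sum_(j < (n 0).+1) weight_coef c j s al.

(** The monomials with block degrees [I]. The condition on the degrees bounds
    the exponents, and the box only provides a finite list. *)
Definition block_fiber r (I : r.-tuple nat) : seq (N.-tuple nat) :=
  [seq al <- box N (msize I).+1 | [forall k : 'I_m, bdeg blk k al == nth 0%N I k]].

Lemma tnth_le_bdeg al v : (tnth al v <= bdeg blk (blk v) al)%N.
Proof. by rewrite /bdeg (bigD1 v)//= leq_addr. Qed.

Lemma suppP r al : reflect (forall k, (r <= k)%N -> bdeg blk k al = 0%N) (supp r al).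
Proof.
apply: (iffP forallP) => [H k rk|H v].
  rewrite /bdeg big1// => v /eqP vk; apply/eqP; have := H v.
  by rewrite vk ltnNge rk implybF negbK.
apply/implyP; rewrite ltnNge => v0; apply: contra v0 => /H bv.
by have := tnth_le_bdeg al v; rewrite bv leqn0.
Qed.

Lemma nth_degs r al k : nth 0%N (degs r al) k = if (k < r)%N then bdeg blk k al else 0%N.
Proof.
case: ltnP => kr; last by rewrite nth_default// size_tuple.
by rewrite (_ : k = Ordinal kr :> nat)// -tnth_nth tnth_mktuple.
Qed.

Lemma msize_degs r al : (r <= m)%N -> supp r al -> msize (degs r al) = msize al.
Proof.
move=> rm /suppP H; rewrite /msize -(bdeg_sum al (@blk_lt m n)).
under eq_bigr do rewrite tnth_mktuple.
rewrite (big_ord_widen m (fun k => bdeg blk k al) rm) [LHS]big_mkcond.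
by apply: eq_bigr => k _; case: ltnP => // /H ->.
Qed.

Lemma mem_block_fiber r (I : r.-tuple nat) al :
  (al \in block_fiber I) = [forall k : 'I_m, bdeg blk k al == nth 0%N I k].
Proof.
rewrite mem_filter andb_idr// => /forallP H; rewrite mem_box; apply/forallP => v.
rewrite ltnS (leq_trans (tnth_le_bdeg al v))//.
have /eqP -> := H (vblk v); case: (ltnP (vblk v) r) => vr; last by rewrite nth_default// size_tuple.
by rewrite -(tnth_nth 0%N I (Ordinal vr)) /msize (bigD1 (Ordinal vr))//= leq_addr.
Qed.

Lemma mem_block_fiber_degs r al : supp r al -> al \in block_fiber (degs r al).
Proof.
move=> /suppP H; rewrite mem_block_fiber; apply/forallP => k; rewrite nth_degs.
by case: ltnP => // /H ->.
Qed.

Lemma degs_block_fiber r (I : r.-tuple nat) al : (r <= m)%N -> al \in block_fiber I ->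
  supp r al /\ degs r al = I.
Proof.
move=> rm; rewrite mem_block_fiber => /forallP H; split.
  apply/forallP => v; apply/implyP; rewrite ltnNge => v0; apply: contra v0 => rv.
  have /eqP := H (vblk v); rewrite nth_default ?size_tuple// => E.
  by have := tnth_le_bdeg al v; rewrite [bdeg _ _ _]E leqn0.
apply: eq_from_tnth => k; rewrite tnth_mktuple (tnth_nth 0%N).
by have /eqP := H (widen_ord rm k).
Qed.

(** The multinomial theorem over the polynomials in [mu], for the terms
    [x_v mu ^ (wt v)]. *)
Lemma fiber_sum r (I : r.-tuple nat) x : (r <= m)%N ->
  \sum_(al <- block_fiber I) (multicoef K m blk al * monomial x al)%:P * 'X^(wsum al) =
  \prod_(k < r) xpol x k ^+ nth 0%N I k.
Proof.
move=> rm; pose D : K := \prod_(k < m) (nth 0%N I k)`!%:R.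
have IB k : (k < m)%N -> (nth 0%N I k < (msize I).+1)%N.
  move=> _; rewrite ltnS; case: (ltnP k r) => kr; last by rewrite nth_default// size_tuple.
  by rewrite -(tnth_nth 0%N I (Ordinal kr)) /msize (bigD1 (Ordinal kr))//= leq_addr.
have := multinomial (polyC : {rmorphism K -> {poly K}})
  (fun v => (x 0 v)%:P * 'X^(wt v)) (@blk_lt m n) IB.
move=> /(congr1 (fun p => D%:P * p)).
have -> : D%:P * \prod_(k < m) dpow polyC (nth 0%N I k) (\sum_(v < N | blk v == k) (x 0 v)%:P * 'X^(wt v)) =
    \prod_(k < r) xpol x k ^+ nth 0%N I k.
  rewrite /D rmorph_prod -big_split /=.
  rewrite (big_ord_widen m (fun k => xpol x k ^+ nth 0%N I k) rm) [RHS]big_mkcond.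
  apply: eq_bigr => k _; rewrite -xpol_sum /dpow mulrA -polyCM mulfV ?mul1r.
    by case: ltnP => // rk; rewrite nth_default ?size_tuple.
  by rewrite pnatr_eq0 -lt0n fact_gt0.
move=> <-; rewrite big_distrr big_filter /=; apply: eq_bigr => al /forallP H.
rewrite /dpow big_split /= -rmorph_prod.
under [X in _ * (_ * X)]eq_bigr do rewrite exprMn -rmorphXn /=.
rewrite big_split /= -rmorph_prod mulrA !mulrA -!polyCM /multicoef /monomial /wsum.
congr (_%:P * _); last by rewrite -prodrXr; apply: eq_bigr => v _; rewrite -exprM mulnC.
by congr (_ * _ * _); apply: eq_bigr => k _; rewrite (eqP (H k)).
Qed.

(** [Lam] is a linear form on the polynomials in [mu], with values [psi] on the
    powers of [mu]. It is either a coefficient or the evaluation at a number: the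
    former turns a power series into a star series, the latter into the function
    [mu |-> phi_j (x_mu)]. *)
Lemma series_fibers c j (Lam : {poly K} -> K) (psi : nat -> K) x l :
  (forall s : seq (N.-tuple nat), forall a : N.-tuple nat -> K,
     Lam (\sum_(al <- s) (a al)%:P * 'X^(wsum al)) = \sum_(al <- s) a al * psi (wsum al)) ->
  abs_summable (fun al => block_coef c j al * monomial x al * psi (wsum al)) ->
  has_sum (fun al => block_coef c j al * monomial x al * psi (wsum al)) l ->
  has_sum (fun I : (nu m n j).-tuple nat =>
    c I j * Lam (\prod_(k < nu m n j) xpol x k ^+ nth 0%N I k)) l.
Proof.
move=> Lin As Al; have num := nu_le m n j.
apply: (@has_sum_finite_fibers _ _ _ (degs (nu m n j)) (@block_fiber (nu m n j)) _ _ _ As Al).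
- by move=> I; rewrite filter_uniq// box_uniq.
- move=> al; rewrite /block_coef; case: ifP => [H _|_]; first exact: mem_block_fiber_degs.
  by rewrite !mul0r eqxx.
move=> I; rewrite -(fiber_sum I x num) Lin big_distrr /= big_mkcond.
apply: eq_big_seq => al /(degs_block_fiber num)[sal dal].
by rewrite dal eqxx /block_coef sal dal !mulrA.
Qed.

(** Dividing the radius by more than the number of variables absorbs the
    multiplicities of the monomials. *)
Lemma block_coef_bound c j rho M : 0 < rho ->
  (forall I : (nu m n j).-tuple nat, `|c I j| * rho ^+ msize I <= M) ->
  forall al, `|block_coef c j al| * (rho / N.+1%:R) ^+ msize al <= M.
Proof.
move=> rho0 cM al.
have M0 : 0 <= M.
  by apply: le_trans (cM [tuple 0%N | _ < nu m n j]); rewrite mulr_ge0// exprn_ge0// ltW.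
rewrite /block_coef; case: ifP => sal; last by rewrite normr0 mul0r.
apply: le_trans (cM (degs (nu m n j) al)); rewrite msize_degs ?nu_le//.
rewrite normrM -mulrA ler_wpM2l// ger0_norm ?multicoef_ge0//.
rewrite exprMn mulrCA -[leRHS]mulr1 ler_wpM2l ?exprn_ge0 ?(ltW rho0)//.
rewrite exprVn ler_pdivrMr ?exprn_gt0// mul1r.
apply: le_trans (multicoef_le _ _ (@blk_lt m n)) _.
by rewrite lerXn2r ?nnegrE// ler_nat.
Qed.

End Coefficients.

Section StarSeries.
Variables (R : realType) (m : nat) (n : nat -> nat).
Hypothesis hm : (0 < m)%N.
Hypothesis hn : forall i j : nat, (i <= j)%N -> (j < m)%N -> (n j <= n i)%N.
Local Notation K := (Cplx R).
Local Notation N := (nvars m n).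
Implicit Types (x : 'rV[K]_N) (al : N.-tuple nat) (c : seq nat -> nat -> K).

(** The growth of the coefficients of a convergent power series, which is all
    that the functions [phi_j] contribute to convergence. *)
Definition geometric_bound c j := exists rho M : K, 0 < rho /\
  forall I : (nu m n j).-tuple nat, `|c I j| * rho ^+ msize I <= M.

Lemma near_summable_block_coef c j : geometric_bound c j ->
  \forall x \near (0 : 'rV[K]_N), abs_summable (fun al => block_coef c j al * monomial x al).
Proof.
move=> [rho [M [rho0 cM]]]; apply/near_polydisc.
have r0 : 0 < rho / N.+1%:R by rewrite divr_gt0.
exists (rho / N.+1%:R / 2); first by rewrite divr_gt0.
move=> x xr; apply: (abs_summable_monomial r0 (block_coef_bound rho0 cM)) => v.
by have := xr v; rewrite subr0.
Qed.

Lemma abs_summable_weight_coef c j s x :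
  abs_summable (fun al => block_coef c j al * monomial x al) ->
  abs_summable (fun al => weight_coef c j s al * monomial x al).
Proof.
move=> /(abs_summableZ j`!%:R) H; apply: abs_summable_le H _ => al.
by rewrite /weight_coef; case: ifP => _; rewrite ?mul0r ?normr0// mulrA.
Qed.

Lemma weight_coef_series c j s x l : (s <= j)%N ->
  abs_summable (fun al => block_coef c j al * monomial x al) ->
  has_sum (fun al => weight_coef c j s al * monomial x al) l ->
  has_sum (fun I : (nu m n j).-tuple nat => j`!%:R * c I j *
    (\prod_(k < nu m n j) xpol x k ^+ nth 0%N I k)`_(j - s)) l.
Proof.
move=> sj As Tl; pose psi w : K := (w == j - s)%N%:R.
have TE al : weight_coef c j s al * monomial x al =
    j`!%:R * (block_coef c j al * monomial x al * psi (wsum al)).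
  rewrite /weight_coef /psi -(eqn_add2r s (wsum al)) subnK//.
  by case: eqP => _; rewrite ?mulr1 ?mulrA ?mulr0 ?mul0r.
have j0 : j`!%:R != 0 :> K by rewrite pnatr_eq0 -lt0n fact_gt0.
have Tl' : has_sum (fun al => block_coef c j al * monomial x al * psi (wsum al)) (j`!%:R^-1 * l).
  by apply: eq_has_sum (has_sumZ (k := j`!%:R^-1) Tl) => al; rewrite TE mulKf.
have As' : abs_summable (fun al => block_coef c j al * monomial x al * psi (wsum al)).
  apply: abs_summable_le As _ => al; rewrite [leLHS]normrM /psi ler_piMr//.
  by case: eqP => _; rewrite ?normr0 ?normr1.
have Lin (t : seq (N.-tuple nat)) (a : N.-tuple nat -> K) :
    (\sum_(al <- t) (a al)%:P * 'X^(wsum al))`_(j - s) = \sum_(al <- t) a al * psi (wsum al).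
  rewrite coef_sum; apply: eq_bigr => al _.
  by rewrite coefCM coefXn /psi eq_sym.
have H := @series_fibers R m n c j (fun p => p`_(j - s)) psi x _ Lin As' Tl'.
have -> : l = j`!%:R * (j`!%:R^-1 * l) by rewrite mulVKf.
by apply: eq_has_sum (has_sumZ (k := j`!%:R) H) => I; rewrite mulrA.
Qed.

(** The coefficients of the star series and the power series with coefficients
    [star_coef] are two groupings of one absolutely convergent family of
    monomials, related superscript by superscript by [weight_coef_series]. *)
Lemma star_series c : (forall j, (j <= n 0)%N -> geometric_bound c j) ->
  \forall x \near (0 : 'rV[K]_N), exists W : 'I_m -> {poly K},
  [/\ forall r : 'I_m, has_poly_sum (fun I : r.+1.-tuple nat =>
        star n 0 (bpol m n c r I) (starpow n 0 (xpol x) I)) (W r),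
      forall l, (l <= n 0)%N ->
        has_sum (fun al => star_coef c (n 0 - l) al * monomial x al) (\sum_r W r)`_l &
      (size (\sum_r W r)%R <= (n 0).+1)%N].
Proof.
move=> cb.
have : \forall x \near (0 : 'rV[K]_N), forall j : 'I_(n 0).+1,
    abs_summable (fun al => block_coef c j al * monomial x al).
  apply: (@filter_forall _ _ (fun (j : 'I_(n 0).+1) x => abs_summable (fun al => block_coef c j al * monomial x al)) (nbhs (0 : 'rV[K]_N))) => j.
  by apply: near_summable_block_coef; apply: cb; rewrite -ltnS.
apply: filterS => x As.
(* The contribution of the superscript [j] to the coefficient of
   [mu ^ (n 0 - s)]. *)
pose L j s : K := xget 0 [set l | has_sum (fun al => weight_coef c j s al * monomial x al) l].
have HL (j : 'I_(n 0).+1) s : has_sum (fun al => weight_coef c j s al * monomial x al) (L j s).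
  have [l Hl] := summable_has_sum (abs_summable_weight_coef s (As j)).
  exact: (xgetPex 0 (ex_intro [set l | has_sum _ l] l Hl)).
have L0 (j : 'I_(n 0).+1) s : (j < s)%N -> L j s = 0.
  move=> js; apply: (has_sum_unique (HL j s)).
  apply: eq_has_sum (@has_sum0 K _) => al; rewrite /weight_coef ifF ?mul0r//.
  by apply/eqP => E; move: js; rewrite -E ltnNge leq_addl.
pose W (r : 'I_m) : {poly K} := \poly_(l < (n 0).+1)
  \sum_(next_lower m n r <= j < (n r).+1) L j (n 0 - l)%N.
have WE l : (\sum_r W r)`_l = if (l < (n 0).+1)%N then
    \sum_(j < (n 0).+1) L j (n 0 - l)%N else 0.
  rewrite coef_sum; under eq_bigr do rewrite coef_poly.
  case: ifP => _; last by rewrite big1.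
  exact: (sum_nu_ranges hn (fun _ j => L j (n 0 - l)%N) hm).
exists W; split.
- move=> r l; rewrite coef_poly; case: ltnP => ln; last first.
    by apply: eq_has_sum (@has_sum0 K _) => I; rewrite coef_star_gt.
  rewrite big_nat; apply: eq_has_sum; last first.
    apply: (@has_sum_big _ _ _ _ _ (fun j (I : r.+1.-tuple nat) => if (n 0 - l <= j)%N then
       j`!%:R * c I j * (\prod_(k < r.+1) xpol x k ^+ nth 0%N I k)`_(j - (n 0 - l)) else 0)).
    move=> j jr.
    have jn : (j < (n 0).+1)%N.
      by case/andP: jr => _ /leq_trans; apply; rewrite ltnS hn.
    move: (jr); rewrite (nu_range hn)// => /eqP E.
    case: leqP => lj; last first.
      by rewrite (L0 (Ordinal jn))//; exact: has_sum0.
    have := weight_coef_series lj (As (Ordinal jn)) (HL (Ordinal jn) _).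
    by rewrite /= E.
  move=> I; rewrite (coef_star_bpol hn _ _ _ (size_tuple I))// big_nat.
  by [].
- move=> l ln; rewrite WE ltnS ln.
  have H := @has_sum_big K _ _ (index_enum 'I_(n 0).+1) xpredT
    (fun j al => weight_coef c j (n 0 - l) al * monomial x al) _ (fun j _ => HL j (n 0 - l)%N).
  by apply: eq_has_sum H => al; rewrite /star_coef big_distrl.
by apply/leq_sizeP => l nl; rewrite WE ltnNge nl.
Qed.

End StarSeries.

(** * Taylor coefficients of formal solutions *)

Section Recurrence.
Variables (R : realType) (m : nat) (n : nat -> nat).
Hypothesis hn : forall i j : nat, (i <= j)%N -> (j < m)%N -> (n j <= n i)%N.
Local Notation K := (Cplx R).
Local Notation N := (nvars m n).
Local Notation blk := (@blk m n).
Local Notation wt := (@wt m n).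
Local Notation mult := (multicoef K m blk).
Implicit Types (v u : 'I_N) (al be : N.-tuple nat) (c : seq nat -> nat -> K).

Lemma incrC u v al : incr u (incr v al) = incr v (incr u al).
Proof. by apply: eq_from_tnth => w; rewrite !tnth_incr addnAC. Qed.

Lemma bdeg_incr k v al : bdeg blk k (incr v al) = (bdeg blk k al + (blk v == k))%N.
Proof.
rewrite /bdeg; under eq_bigr do rewrite tnth_incr.
rewrite big_split /=; congr addn.
case: (blk v =P k) => vk; last first.
  by rewrite big1// => w /eqP wk; case: eqP => // E; case: vk; rewrite -E.
rewrite (bigD1 v) ?vk ?eqxx//= big1 ?addn0//.
by move=> w /andP[_ /negbTE ->].
Qed.

Lemma wsum_incr v al : wsum (incr v al) = (wsum al + wt v)%N.
Proof.
rewrite /wsum; under eq_bigr do rewrite tnth_incr mulnDl.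
rewrite big_split /=; congr addn.
by rewrite (bigD1 v)//= eqxx mul1n big1 ?addn0// => w /negbTE ->.
Qed.

Lemma supp_incr r v al : supp r (incr v al) = supp r al && (blk v < r)%N.
Proof.
apply/suppP/andP => [H|[/suppP H vr] k rk].
  split; last first.
    rewrite ltnNge; apply/negP => /H; rewrite bdeg_incr eqxx addn1.
    by [].
  by apply/suppP => k /H; rewrite bdeg_incr => /eqP; rewrite addn_eq0 => /andP[/eqP].
rewrite bdeg_incr H// add0n; case: eqP => // E.
by move: vr; rewrite E ltnNge rk.
Qed.

(** The factor between coefficients and derivatives at the centre. *)
Definition mfact al : K := \prod_(v < N) (tnth al v)`!%:R.

Lemma mfact_neq0 al : mfact al != 0.
Proof. by apply/prodf_neq0 => v _; rewrite pnatr_eq0 -lt0n fact_gt0. Qed.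

Lemma mfact_incr v al : mfact (incr v al) = (tnth al v).+1%:R * mfact al.
Proof.
rewrite /mfact (bigD1 v)//= [in RHS](bigD1 v)//= tnth_incr eqxx addn1 factS natrM mulrA.
by congr (_ * _); apply: eq_bigr => w /negbTE wv; rewrite tnth_incr wv addn0.
Qed.

Lemma mult_mfact al : mult al * mfact al = \prod_(k < m) (bdeg blk k al)`!%:R.
Proof.
rewrite /multicoef /mfact -mulrA -big_split -[RHS]mulr1 /=; congr (_ * _).
rewrite big1// => v _.
by rewrite mulVf// pnatr_eq0 -lt0n fact_gt0.
Qed.

Lemma mult_neq0 al : mult al != 0.
Proof.
have : mult al * mfact al != 0.
  by rewrite mult_mfact; apply/prodf_neq0 => k _; rewrite pnatr_eq0 -lt0n fact_gt0.
by rewrite mulf_eq0 negb_or => /andP[].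
Qed.

Lemma leq_prod_fact (T : finType) (P : pred T) (f : T -> nat) :
  (\prod_(v | P v) (f v)`! <= (\sum_(v | P v) f v)`!)%N.
Proof.
elim/big_rec2: _ => // v a b _ ab.
apply: leq_trans (leq_mul (leqnn _) ab) _.
by rewrite -(bin_fact (leq_addr _ (f v))) addKn leq_pmull// bin_gt0 leq_addr.
Qed.

(** Block by block, a product of factorials is at most the factorial of the
    sum. *)
Lemma mult_ge1 al : 1 <= mult al.
Proof.
rewrite -(ler_pM2r (_ : 0 < mfact al)); last first.
  by rewrite prodr_gt0// => v _; rewrite ltr0n fact_gt0.
rewrite mul1r mult_mfact /mfact -!natr_prod ler_nat.
rewrite (partition_big (@vblk m n) xpredT)//=.
by apply: leq_prod => k _; exact: leq_prod_fact.
Qed.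

(** Multiplication by one or another variable of the same block leads to the
    same block degrees; the factors compensate for the different factorials. *)
Lemma block_coef_incr c j v u al : blk v = blk u ->
  (tnth al v).+1%:R * block_coef c j (incr v al) = (tnth al u).+1%:R * block_coef c j (incr u al).
Proof.
move=> vu; rewrite /block_coef !supp_incr vu; case: (_ && _); last by rewrite !mulr0.
have -> : degs (nu m n j) (incr v al) = degs (nu m n j) (incr u al).
  by apply: eq_from_tnth => k; rewrite !tnth_mktuple !bdeg_incr vu.
rewrite mulrCA [RHS]mulrCA; congr (_ * _).
apply: (mulIf (mfact_neq0 al)).
have key w : (tnth al w).+1%:R * mult (incr w al) * mfact al =
    \prod_(k < m) (bdeg blk k (incr w al))`!%:R.
  by rewrite -mult_mfact mfact_incr -mulrA mulrCA.
rewrite !key.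
by apply: eq_bigr => k _; rewrite !bdeg_incr vu.
Qed.

Lemma star_coefE c s al :
  star_coef c s al = if (wsum al + s <= n 0)%N then
    (wsum al + s)`!%:R * block_coef c (wsum al + s) al else 0.
Proof.
rewrite /star_coef /weight_coef; case: leqP => h; last first.
  rewrite big1// => j _; case: eqP => // E; move: h.
  by rewrite E ltnNge -ltnS ltn_ord.
rewrite (bigD1 (Ordinal (h : (_ < (n 0).+1)%N)))//= eqxx big1 ?addr0//.
by move=> j; rewrite -val_eqE /= eq_sym => /negbTE ->.
Qed.

(** The series for [s = 0] and [s = 1] solve [grad h = U grad g] term by term.
    Passing from [v] to [vnext v] raises the weight by one, which makes up for the
    difference in [s]. If [v] is the last variable of its block, the superscript
    involved is too large for the block and the coefficient vanishes. *)
Lemma star_coef_rel c v al : dcoef v (star_coef c 1) al =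
  if (wt v < n (blk v))%N then dcoef (vnext v) (star_coef c 0) al else 0.
Proof.
rewrite /dcoef !star_coefE; case: ltnP => h.
  have -> : (wsum (incr v al) + 1 = wsum (incr (vnext v) al) + 0)%N.
    by rewrite !wsum_incr wt_vnext// addn0 addn1 addnS.
  set w := (_ + 0)%N; case: (w <= n 0)%N; last by rewrite !mulr0.
  rewrite mulrCA [RHS]mulrCA; congr (_ * _).
  by apply: block_coef_incr; rewrite blk_vnext.
case: ifP => _; last by rewrite mulr0.
rewrite /block_coef ifF ?mulr0// supp_incr lt_nu ?blk_lt// wsum_incr.
by rewrite [X in _ && X](_ : _ = false) ?andbF//; lia.
Qed.

End Recurrence.

Section FormalSolutions.
Variables (R : realType) (m : nat) (n : nat -> nat).
Hypothesis hn : forall i j : nat, (i <= j)%N -> (j < m)%N -> (n j <= n i)%N.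
Local Notation K := (Cplx R).
Local Notation N := (nvars m n).
Local Notation blk := (@blk m n).
Local Notation wt := (@wt m n).
Local Notation mult := (multicoef K m blk).
Local Notation mfact := (@mfact R m n).
Implicit Types (v u : 'I_N) (al be : N.-tuple nat).
Variables cg ch : N.-tuple nat -> K.
Hypothesis formal : forall v al, dcoef v ch al =
  if (wt v < n (blk v))%N then dcoef (vnext v) cg al else 0.

(** Derivatives at the centre, for which the equations have no numerical
    factors. *)
Let tayg al := mfact al * cg al.
Let tayh al := mfact al * ch al.

Lemma taylor_rel v al :
  tayh (incr v al) = if (wt v < n (blk v))%N then tayg (incr (vnext v) al) else 0.
Proof.
have dE w (c : N.-tuple nat -> K) : mfact (incr w al) * c (incr w al) = mfact al * dcoef w c al.
  by rewrite mfact_incr /dcoef mulrCA -mulrA.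
by rewrite /tayh /tayg dE formal; case: ifP => _; rewrite ?mulr0// dE.
Qed.

(** The monomial that has the block degrees of [be] and involves the first
    variable of each block only. *)
Definition flat be : N.-tuple nat :=
  [tuple if wt v == 0%N then bdeg blk (blk v) be else 0%N | v < N].

Lemma flat_id be : wsum be = 0%N -> flat be = be.
Proof.
move=> /eqP; rewrite sum_nat_eq0 => /forallP w0.
have b0 v : wt v != 0%N -> tnth be v = 0%N.
  by move=> v0; apply/eqP; have := w0 v; rewrite /= muln_eq0 (negbTE v0) orbF.
apply: eq_from_tnth => v; rewrite tnth_mktuple; case: eqP => v0.
  rewrite /bdeg (bigD1 v)//= big1 ?addn0// => u /andP[/eqP uv uNv]; apply: b0.
  by apply: contra uNv => /eqP u0; apply/eqP/var_inj => //; rewrite v0.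
by rewrite b0//; apply/eqP.
Qed.

Lemma flat_bdeg be be' : (forall k, bdeg blk k be = bdeg blk k be') -> flat be = flat be'.
Proof. by move=> H; apply: eq_from_tnth => v; rewrite !tnth_mktuple H. Qed.

(** By [taylor_rel] used twice, with the coefficients of [h] as intermediaries,
    a unit of weight can be moved from any variable to [u] without changing the
    derivative of [g]. All the weight of [be] ends up on [u], and the derivative
    is 0 if there is no room for it in the block of [u]. *)
Lemma taylor_gather u be : tayg (incr u be) =
  if (wt u + wsum be <= n (blk u))%N then
    tayg (incr (var n (vblk u) (wt u + wsum be)) (flat be)) else 0.
Proof.
have [k kE] : exists k, wsum be = k by exists (wsum be).
elim: k u be kE => [|k IH] u be kE.
  by rewrite kE addn0 wt_le varE flat_id.
have [v' /andP[bv' wv']] : exists v', (tnth be v' != 0%N) && (wt v' != 0%N).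
  apply/existsP; apply: contraPT kE; rewrite negb_exists => /forallP H.
  rewrite /wsum big1// => v _; apply/eqP; rewrite muln_eq0.
  by have := H v; rewrite negb_and !negbK.
(* One unit of weight goes from [v'] to [u], through the coefficient of [h]
   at [u] and the variable [v] that precedes [v']. *)
pose v := var n (vblk v') (wt v').-1.
have wv : wt v = (wt v').-1.
  by rewrite wt_var// (leq_trans (leq_pred _))// wt_le.
have bv : blk v = blk v' by rewrite blk_var.
have wv1 : (wt v).+1 = wt v' by rewrite wv prednK// lt0n.
have hv : (wt v < n (blk v))%N by rewrite bv wv1 wt_le.
have vE : vnext v = v'.
  by apply: var_inj; [rewrite blk_vnext | rewrite wt_vnext].
pose be' := decr v' be; have beE : be = incr v' be' by rewrite decrK.
have wE : wsum (incr v be') = k.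
  by apply: succn_inj; rewrite -kE beE !wsum_incr -wv1 addnS.
have -> : tayg (incr u be) = tayh (incr u (incr v be')).
  by rewrite incrC taylor_rel hv vE beE incrC.
have fE : flat (incr v be') = flat be.
  by apply: flat_bdeg => i; rewrite beE !bdeg_incr bv.
rewrite taylor_rel; case: ltnP => hu.
  rewrite IH// wE blk_vnext wt_vnext// kE addSnnS fE /vnext vblk_var.
  by [].
by rewrite ifF//; apply/negbTE; rewrite -ltnNge kE; lia.
Qed.

(** Both sides are gathered on variables of one block, which produces the same
    monomial. *)
Lemma taylor_invariant al al' : al != zero_idx N ->
  (forall k, bdeg blk k al = bdeg blk k al') -> wsum al = wsum al' ->
  tayg al = tayg al'.
Proof.
move=> /msize_neq0[u au] degE wE.
have [u' /andP[/eqP uu' au']] : exists u', (blk u' == blk u) && (tnth al' u' != 0%N).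
  apply/existsP; apply: contraPT (degE (blk u)); rewrite negb_exists => /forallP H.
  move=> E; move: au; rewrite -leqn0 => /negP; apply.
  rewrite (leq_trans (tnth_le_bdeg _ _))// E /bdeg big1// => v vu.
  by apply/eqP; have := H v; rewrite vu /= negbK.
have := taylor_gather u' (decr u' al'); rewrite decrK// => ->.
have := taylor_gather u (decr u al); rewrite decrK// => ->.
have w1 : (wt u + wsum (decr u al) = wsum al)%N.
  by rewrite addnC -wsum_incr decrK.
have w2 : (wt u' + wsum (decr u' al') = wsum al)%N.
  by rewrite wE addnC -wsum_incr decrK.
rewrite w1 w2 uu'; have -> : vblk u' = vblk u by apply: val_inj.
rewrite (@flat_bdeg (decr u al) (decr u' al'))// => k.
by apply: (@addIn (blk u == k)); rewrite -{2}uu' -!bdeg_incr !decrK.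
Qed.

Lemma taylor_vanish al u : tnth al u != 0%N -> (n (blk u) < wsum al)%N -> cg al = 0.
Proof.
move=> au h; have : tayg al = 0.
  have := taylor_gather u (decr u al); rewrite decrK// => ->.
  rewrite ifF//; apply/negbTE; rewrite -ltnNge.
  by rewrite addnC -wsum_incr decrK.
by move=> /eqP; rewrite mulf_eq0 (negbTE (mfact_neq0 _ _)) => /eqP.
Qed.

Definition same_degs (I : seq nat) j : set (N.-tuple nat) :=
  [set al | (forall k : 'I_m, bdeg blk k al = nth 0%N I k) /\ wsum al = j].

(** The coefficients [c_(I,j)] read off from the coefficients of [g]: up to the
    normalization, any monomial with block degrees [I] and weight [j] gives the
    same value by [taylor_invariant]. The multi-index 0 is special: the constant
    terms of [g] and [h] are recorded as [c_(0,0)] and [c_(0,1)]. *)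
Definition ccoef (I : seq nat) (j : nat) : K :=
  if all (pred1 0%N) I then (if j == 0%N then cg (zero_idx N) else ch (zero_idx N))
  else if `[< same_degs I j !=set0 >] then
    let al := xget (zero_idx N) (same_degs I j) in cg al / (j`!%:R * mult al)
  else 0.

(** Multiplicities and factorials are at least 1, so that dividing by them does
    not spoil the bound on the coefficients of [g]. *)
Lemma ccoef_bound rho M : 0 < rho -> (forall al, `|cg al| * rho ^+ msize al <= M) ->
  forall j, geometric_bound m n ccoef j.
Proof.
move=> rho0 cM j; exists rho, (M + `|ch (zero_idx N)|); split => // I.
have M0 : 0 <= M.
  by apply: le_trans (cM (zero_idx N)); rewrite mulr_ge0// exprn_ge0// ltW.
rewrite /ccoef; case: ifP => [/allP I0|_].
  have -> : msize I = 0%N.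
    by rewrite /msize big1// => k _; apply/eqP; exact: (I0 _ (mem_tnth _ _)).
  rewrite expr0 mulr1; case: ifP => _; last by rewrite lerDr.
  have := cM (zero_idx N); rewrite (_ : msize _ = 0%N) ?expr0 ?mulr1; last first.
    by rewrite /msize big1// => v _; rewrite tnth_mktuple.
  by move=> h; apply: le_trans h _; rewrite lerDl.
apply: (@le_trans _ _ M); last by rewrite lerDl.
case: ifP => [/asboolP ex|_]; last by rewrite normr0 mul0r.
have [] := xgetPex (zero_idx N) ex; set al := xget _ _ => /= degE _.
have -> : msize I = msize al.
  rewrite {2}/msize -(bdeg_sum al (@blk_lt m n)) /msize.
  under eq_bigr do rewrite (tnth_nth 0%N).
  rewrite (big_ord_widen m (fun k => nth 0%N I k) (nu_le _ _ _)) big_mkcond.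
  by apply: eq_bigr => k _; rewrite degE; case: ltnP => // h; rewrite nth_default// size_tuple.
apply: le_trans (cM al); rewrite normrM; apply: ler_wpM2r; first by rewrite exprn_ge0// ltW.
rewrite ler_piMr// normfV invf_le1.
  rewrite normrM normr_nat (ger0_norm (multicoef_ge0 _ _ _ _)).
  by rewrite mulr_ege1 ?mult_ge1// ler1n fact_gt0.
by rewrite normr_gt0 mulf_neq0 ?mult_neq0// pnatr_eq0 -lt0n fact_gt0.
Qed.

Lemma wsum0 : wsum (zero_idx N) = 0%N.
Proof. by rewrite /wsum big1// => v _; rewrite tnth_mktuple. Qed.

Lemma block_coef_ccoef_zero j : block_coef ccoef j (zero_idx N) =
  if j == 0%N then cg (zero_idx N) else ch (zero_idx N).
Proof.
have b0 k : bdeg blk k (zero_idx N) = 0%N.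
  by rewrite /bdeg big1// => v _; rewrite tnth_mktuple.
rewrite /block_coef ifT; last by apply/forallP => v; rewrite tnth_mktuple.
have -> : mult (zero_idx N) = 1.
  rewrite /multicoef !big1 ?mulr1// => [v _|k _]; last by rewrite b0.
  by rewrite tnth_mktuple invr1.
rewrite mulr1 /ccoef ifT//.
by apply/allP => i /tnthP[k ->]; rewrite tnth_mktuple b0 /=.
Qed.

(** If a block met by [al] is too small for the weight of [al], both sides are
    0. Otherwise the monomial chosen in [ccoef] has the same derivative as [al],
    and the normalizations agree. *)
Lemma star_coef_ccoef0 al : star_coef ccoef 0 al = cg al.
Proof.
rewrite star_coefE addn0; have [->|al0] := eqVneq al (zero_idx N).
  by rewrite wsum0 leq0n fact0 mul1r block_coef_ccoef_zero.
have [u au] := msize_neq0 al0; set j := wsum al.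
have [supal|nsup] := boolP (supp (nu m n j) al); last first.
  move: (nsup); rewrite negb_forall => /existsP[v]; rewrite negb_imply lt_nu ?blk_lt//.
  rewrite -ltnNge => /andP[av jv].
  by rewrite (taylor_vanish av jv) /block_coef (negbTE nsup) mulr0 if_same.
have bu : (blk u < nu m n j)%N by have /forallP/(_ u) := supal; rewrite au.
have ju : (j <= n (blk u))%N by rewrite -(lt_nu hn)// blk_lt.
have jn : (j <= n 0)%N by apply: leq_trans ju _; apply: hn => //; exact: blk_lt.
rewrite jn /block_coef supal /ccoef ifF; last first.
  apply/negbTE/allPn; exists (bdeg blk (blk u) al).
    by apply/tnthP; exists (Ordinal bu); rewrite tnth_mktuple.
  by rewrite /= -lt0n (leq_trans _ (tnth_le_bdeg al u))// lt0n.
have ex : same_degs (degs (nu m n j) al) j !=set0.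
  exists al; split => // k; rewrite nth_degs; case: ltnP => // h.
  by have /suppP := supal; apply.
rewrite (asboolT ex); have [] := xgetPex (zero_idx N) ex; set be := xget _ _ => /= degE wE.
have degE' k : bdeg blk k al = bdeg blk k be.
  have [km|mk] := ltnP k m.
    rewrite (degE (Ordinal km)) nth_degs; case: ltnP => // h.
    by have /suppP := supal; apply.
  by rewrite /bdeg !big1// => v /eqP vk; have := blk_lt v; rewrite vk ltnNge mk.
have := taylor_invariant al0 degE' (esym wE).
have := mult_mfact R al; have := mult_mfact R be.
have -> : \prod_(k < m) (bdeg blk k be)`!%:R = \prod_(k < m) (bdeg blk k al)`!%:R :> K.
  by apply: eq_bigr => k _; rewrite degE'.
move=> <- mE; rewrite /tayg => tE.
have f0 : j`!%:R != 0 :> K by rewrite pnatr_eq0 -lt0n fact_gt0.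
have aux (f mb ma fb fa ga gb : K) : f != 0 -> mb != 0 -> fa != 0 ->
    ma * fa = mb * fb -> fa * ga = fb * gb -> f * (gb / (f * mb) * ma) = ga.
  move=> f0' mb0 fa0 E1 E2; apply: (mulfI fa0); apply: (mulfI mb0).
  have -> : mb * (fa * (f * (gb / (f * mb) * ma))) = (ma * fa) * gb.
    by field; rewrite f0' mb0.
  by rewrite E1 E2 mulrA.
exact: (aux _ _ _ _ _ _ _ f0 (mult_neq0 _ be) (mfact_neq0 _ al) mE tE).
Qed.

(** Coefficients of positive degree of [h] are determined by those of [g],
    through [star_coef_rel]; the constant term is [c_(0,1)]. *)
Lemma star_coef_ccoef1 al : (0 < n 0)%N -> star_coef ccoef 1 al = ch al.
Proof.
move=> n0; have [->|al0] := eqVneq al (zero_idx N).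
  by rewrite star_coefE wsum0 add0n n0 mul1r block_coef_ccoef_zero.
have [u au] := msize_neq0 al0.
have := star_coef_rel hn ccoef u (decr u al).
have <- : dcoef u ch (decr u al) = (if (wt u < n (blk u))%N then dcoef (vnext u) (star_coef ccoef 0) (decr u al) else 0).
  by rewrite formal /dcoef; case: ifP => //; rewrite star_coef_ccoef0.
rewrite /dcoef decrK// => /mulfI; apply.
by rewrite pnatr_eq0.
Qed.

End FormalSolutions.

(** * Analytic solutions *)

Section Assembly.
Variables (R : realType) (m : nat) (n : nat -> nat).
Hypothesis hm : (0 < m)%N.
Hypothesis hn : forall i j : nat, (i <= j)%N -> (j < m)%N -> (n j <= n i)%N.
Local Notation K := (Cplx R).
Local Notation N := (nvars m n).
Local Notation blk := (@blk m n).
Local Notation wt := (@wt m n).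
Implicit Types (x p : 'rV[K]_N) (al : N.-tuple nat) (c : seq nat -> nat -> K).

Lemma power_series_shift N' (c : N'.-tuple nat -> K) f (p : 'rV[K]_N') :
  has_power_series c f p ->
  \forall x \near (0 : 'rV[K]_N'), has_sum (fun I => c I * monomial x I) (f (p + x)).
Proof.
move=> /power_series_bound[r [M [r0 _ H]]]; apply/near_polydisc; exists r => // x xr.
have := H (p + x); rewrite [p + x]addrC addrK; apply => v.
by have := xr v; rewrite subr0.
Qed.

Lemma grad_row (h g : 'rV[K]_N -> K) x v :
  grad h x = Umx K m n *m grad g x ->
  'D_(delta_mx 0 v) h x =
  if (wt v < n (blk v))%N then 'D_(delta_mx 0 (vnext v)) g x else 0.
Proof.
move=> /(congr1 (fun A : 'cV[K]_N => A v 0)); rewrite mxE => ->.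
have := Umx_mul (idfun : {rmorphism K -> K}) (grad g x) v.
by rewrite map_mx_id// => ->; case: ifP => _ //; rewrite mxE.
Qed.

(** Comparison of the power series of the two sides of each row of the
    equation. *)
Lemma formal_of_solution (D : set 'rV[K]_N) (h g : 'rV[K]_N -> K) cg ch p :
  open D -> D p -> (forall x, D x -> grad h x = Umx K m n *m grad g x) ->
  has_power_series cg g p -> has_power_series ch h p ->
  forall v al, dcoef v ch al =
    if (wt v < n (blk v))%N then dcoef (vnext v) cg al else 0.
Proof.
move=> oD Dp Dgrad Hg Hh v.
have nD : \forall x \near p, D x by exact: open_nbhs_nbhs.
have Hv := power_series_derivative v Hh.
case: ltnP => hv.
  apply: (power_series_unique Hv (power_series_derivative (vnext v) Hg)).
  by apply: filterS nD => x /Dgrad/(grad_row v) ->; rewrite hv.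
move=> al; rewrite (power_series_unique Hv (has_power_series_cst 0 p)) ?if_same//.
by apply: filterS nD => x /Dgrad/(grad_row v) ->; rewrite ltnNge hv.
Qed.

Lemma solution_star_analytic (D : set 'rV[K]_N) (h g : 'rV[K]_N -> K) :
  open D -> analytic_solution D h g -> star_analytic D h g.
Proof.
move=> oD [ah ag Dgrad] p Dp.
have [ch Hh] := ah p Dp; have [cg Hg] := ag p Dp.
have formal := formal_of_solution oD Dp Dgrad Hg Hh.
have [r [M [r0 cM _]]] := power_series_bound Hg.
have cb j : (j <= n 0)%N -> geometric_bound m n (ccoef cg ch) j.
  by move=> _; exact: (ccoef_bound ch r0 cM).
(* One series for each length of multi-indices, in the variables [x^s_mu]. *)
exists m, (fun t => t.+1), (fun t I => bpol m n (ccoef cg ch) t I), (fun t s x => xpol x s).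
split.
- by move=> t; exact: ltn_ord.
- by move=> t I; exact: bpol_constant_solution.
- move=> t s st; apply: xpol_simple_solution; exact: leq_trans st (ltn_ord t).
apply: filterS3 (star_series hm hn cb) (power_series_shift Hg) (power_series_shift Hh).
move=> x [W [HW Wl _]] gx hx; exists W; split => //.
  have := Wl _ (leqnn _); rewrite subnn => H.
  apply: has_sum_unique gx _; apply: eq_has_sum H => al.
  by rewrite (star_coef_ccoef0 hn formal).
move=> n0; have := Wl _ (leq_pred (n 0)).
have -> : (n 0 - (n 0).-1 = 1)%N by lia.
move=> H; apply: has_sum_unique hx _; apply: eq_has_sum H => al.
by rewrite (star_coef_ccoef1 hn formal).
Qed.

(** For small [x], the function [mu |-> phi_j (x_mu)] is the sum of a series in
    [mu] indexed by the monomials in [x], with exponents [wsum]. *)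
Lemma derive1n_phi j (phi : 'rV[K]_(nu m n j) -> K) c :
  has_power_series (fun I : (nu m n j).-tuple nat => c I j) phi 0 ->
  \forall x \near (0 : 'rV[K]_N),
    has_sum (fun al => weight_coef c j 0 al * monomial x al)
      (derive1n j (fun mu : K => phi (xeval j x mu)) 0).
Proof.
move=> /power_series_bound[rho [M [rho0 cM phiE]]].
have cb : geometric_bound m n c j by exists rho, M.
have nx : \forall x \near (0 : 'rV[K]_N), forall v : 'I_N, `|(x : 'rV[K]_N) 0 v| <= rho / N.+1%:R.
  apply/near_polydisc; exists (rho / N.+1%:R); first by rewrite divr_gt0.
  by move=> x xr v; have := xr v; rewrite subr0.
apply: filterS2 (near_summable_block_coef cb) nx => x As xr.
pose C al := block_coef c j al * monomial x al.
(* With [x] small enough, the series converges for [`|mu| <= 1]. *)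
have HF : sums_on_disc C (@wsum m n) 1 (fun mu => phi (xeval j x mu)).
  split => //.
    by apply: abs_summable_le As _ => al; rewrite expr1n mulr1.
  move=> z z1.
  have As' : abs_summable (fun al => C al * z ^+ wsum al).
    apply: abs_summable_le As _ => al; rewrite [leLHS]normrM ler_piMr//.
    by rewrite normrX exprn_ile1.
  have [l Hl] := summable_has_sum As'.
  have := @series_fibers R m n c j (fun q => q.[z]) (fun w => z ^+ w) x l _ As' Hl.
  have Lin (s : seq (N.-tuple nat)) (a : N.-tuple nat -> K) :
      (\sum_(al <- s) (a al)%:P * 'X^(wsum al)).[z] = \sum_(al <- s) a al * z ^+ wsum al.
    by rewrite horner_sum; apply: eq_bigr => al _; rewrite hornerCM hornerXn.
  move=> /(_ Lin) H.
  suff <- : l = phi (xeval j x z) by [].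
  apply: has_sum_unique H _.
  have yr k : `|(xeval j x z - 0) 0 k| <= rho.
    have km : (k < m)%N by exact: leq_trans (ltn_ord k) (nu_le _ _ _).
    rewrite subr0 mxE (xpol_sum x (Ordinal km)) horner_sum.
    apply: le_trans (ler_norm_sum _ _ _) _.
    apply: (@le_trans _ _ (\sum_(v < N) rho / N.+1%:R)).
      rewrite big_mkcond /=; apply: ler_sum => v _.
      case: ifP => _; last by rewrite divr_ge0// ltW.
      rewrite hornerCM hornerXn normrM (le_trans _ (xr v))// ler_piMr//.
      by rewrite normrX exprn_ile1.
    rewrite sumr_const card_ord -[leLHS]mulr_natr.
    have -> : rho / N.+1%:R * N%:R = rho * (N%:R / N.+1%:R) :> K.
      by rewrite mulrAC mulrA.
    by rewrite ler_piMr ?(ltW rho0)// ler_pdivrMr// mul1r ler_nat.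
  apply: eq_has_sum (phiE _ yr) => I; rewrite subr0 /monomial; congr (_ * _).
  rewrite horner_prod; apply: eq_bigr => k _.
  by rewrite horner_exp mxE (tnth_nth 0%N).
have H := @derive1n_has_sum R _ _ _ _ _ j HF; apply: eq_has_sum H => al.
by rewrite /weight_coef addn0 /C; case: ifP => _; rewrite ?mul0r// mulrA.
Qed.

Lemma coef_lhs_pol (V : nat -> K) (a b : K) (P : {poly K}) :
  (size P <= (n 0).+1)%N -> P`_(n 0) = b ->
  ((0 < n 0)%N -> P`_(n 0).-1 = a) ->
  (forall k, (k < (n 0).-1)%N -> V k = P`_k) -> lhs_pol n V a b = P.
Proof.
rewrite /lhs_pol; case: (n 0) => [|d] sP Pb Pa PV.
  by rewrite -Pb [RHS]size1_polyC.
have -> : P = \poly_(i < d.+2) P`_i.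
  apply/polyP => i; rewrite coef_poly; case: ltnP => // di.
  by rewrite nth_default// (leq_trans sP).
rewrite poly_def !big_ord_recr /= Pa// Pb; congr (_ + _ + _).
by apply: eq_bigr => k _; rewrite PV.
Qed.

Lemma solution_representation (D : set 'rV[K]_N) (h g : 'rV[K]_N -> K)
    (phi : forall j, 'rV[K]_(nu m n j) -> K) c :
  open D -> D 0 -> analytic_solution D h g ->
  (forall j, (j <= n 0)%N ->
     has_power_series (fun I : (nu m n j).-tuple nat => c I j) (phi j) 0) ->
  (\forall x \near (0 : 'rV[K]_N),
     g x = \sum_(j < (n 0).+1) derive1n j (fun mu : K => phi j (xeval j x mu)) 0) ->
  exists (V : nat -> 'rV[K]_N -> K) (a : K),
    \forall x \near (0 : 'rV[K]_N), exists W : 'I_m -> {poly K},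
      (forall r : 'I_m, has_poly_sum (fun I : r.+1.-tuple nat =>
         star n 0 (bpol m n c r I) (starpow n 0 (xpol x) I)) (W r)) /\
      lhs_pol n (fun k => V k x) (h x + a) (g x) = \sum_(r < m) W r.
Proof.
move=> oD D0 [ah ag Dgrad] phiE gE.
have cb j : (j <= n 0)%N -> geometric_bound m n c j.
  move=> /phiE/power_series_bound[rho [M [rho0 cM _]]].
  by exists rho, M.
have gT : \forall x \near (0 : 'rV[K]_N),
    has_sum (fun al => star_coef c 0 al * monomial x al) (g x).
  have H : \forall x \near (0 : 'rV[K]_N), forall j : 'I_(n 0).+1,
      has_sum (fun al => weight_coef c j 0 al * monomial x al)
        (derive1n j (fun mu : K => phi j (xeval j x mu)) 0).
    apply: (@filter_forall _ _ (fun (j : 'I_(n 0).+1) (x : 'rV[K]_N) =>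
      has_sum (fun al => weight_coef c j 0 al * monomial x al)
        (derive1n j (fun mu : K => phi j (xeval j x mu)) 0)) (nbhs (0 : 'rV[K]_N))) => j.
    by apply: derive1n_phi; apply: phiE; rewrite -ltnS.
  apply: filterS2 gE H => x -> H.
  have S := @has_sum_big K _ _ (index_enum 'I_(n 0).+1) xpredT
    (fun j al => weight_coef c j 0 al * monomial x al) _ (fun j _ => H j).
  by apply: eq_has_sum S => al; rewrite /star_coef big_distrl.
have Hg : has_power_series (star_coef c 0) g 0.
  apply: filterS gT => x; apply: eq_has_sum => al; by rewrite subr0.
have [ch Hh] := ah 0 D0.
have formal := formal_of_solution oD D0 Dgrad Hg Hh.
(* Only the constant term of [h] is not determined by [g]. *)
have chE al : al != zero_idx N -> ch al = star_coef c 1 al.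
  move=> /msize_neq0[u au].
  have := star_coef_rel hn c u (decr u al); rewrite -formal /dcoef decrK//.
  by move=> /mulfI ->//; rewrite pnatr_eq0.
pose V k x : K := xget 0 [set l | has_sum (fun al => star_coef c (n 0 - k) al * monomial x al) l].
exists V, (star_coef c 1 (zero_idx N) - ch (zero_idx N)).
apply: filterS3 (star_series hm hn cb) gT (power_series_shift Hh).
move=> x [W [HW Wl sW]] gx; rewrite add0r => hx; exists W; split => //.
apply: coef_lhs_pol => //.
- have := Wl _ (leqnn _); rewrite subnn => H.
  exact: has_sum_unique H gx.
- move=> n0; have := Wl _ (leq_pred (n 0)).
  have -> : (n 0 - (n 0).-1 = 1)%N by lia.
  move=> H; apply: has_sum_unique H _.
  have S := @has_sum_seq K _ (fun al => (star_coef c 1 al - ch al) * monomial x al)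
    [:: zero_idx N] isT.
  have /S {}S (al : N.-tuple nat) : al \notin [:: zero_idx N] ->
      (star_coef c 1 al - ch al) * monomial x al = 0.
    by rewrite inE => /chE ->; rewrite subrr mul0r.
  move: S; rewrite big_seq1 {2}/monomial big1 ?mulr1 => [S|v _]; last by rewrite tnth_mktuple.
  apply: eq_has_sum (has_sumD hx S) => al.
  by rewrite -mulrDl addrC subrK.
move=> k kn; have kn0 : (k <= n 0)%N by rewrite (leq_trans (ltnW kn))// leq_pred.
have H := Wl k kn0; apply: (has_sum_unique _ H).
exact: (xgetPex 0 (ex_intro [set l | has_sum _ l] _ H)).
Qed.

End Assembly.

Theorem theorem7 (R : realType) (m : nat) (n : nat -> nat)
    (hm : (0 < m)%N)
    (hn : forall i j : nat, (i <= j)%N -> (j < m)%N -> (n j <= n i)%N) :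
  (forall (D : set 'rV[Cplx R]_(nvars m n))
          (h g : 'rV[Cplx R]_(nvars m n) -> Cplx R),
     open D -> analytic_solution D h g -> star_analytic D h g)
  /\
  (forall (D : set 'rV[Cplx R]_(nvars m n))
          (h g : 'rV[Cplx R]_(nvars m n) -> Cplx R)
          (phi : forall j : nat, 'rV[Cplx R]_(nu m n j) -> Cplx R)
          (c : seq nat -> nat -> Cplx R),
     open D -> D 0 -> analytic_solution D h g ->
     (forall j : nat, (j <= n 0)%N ->
        has_power_series (fun I : (nu m n j).-tuple nat => c I j) (phi j) 0) ->
     (\forall x \near (0 : 'rV[Cplx R]_(nvars m n)),
        g x = \sum_(j < (n 0%N).+1)
                derive1n j (fun mu : Cplx R => phi j (xeval j x mu)) 0) ->
     (forall (r : 'I_m) (I : r.+1.-tuple nat),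
        constant_solution m n 0 (bpol m n c r I)) /\
     exists (V : nat -> 'rV[Cplx R]_(nvars m n) -> Cplx R) (a : Cplx R),
       \forall x \near (0 : 'rV[Cplx R]_(nvars m n)),
       exists W : 'I_m -> {poly Cplx R},
         (forall r : 'I_m,
            has_poly_sum
              (fun I : r.+1.-tuple nat =>
                 star n 0 (bpol m n c r I) (starpow n 0 (xpol x) I))
              (W r)) /\
         lhs_pol n (fun k => V k x) (h x + a) (g x) = \sum_(r < m) W r).
Proof.
split; first by move=> D h g; exact: solution_star_analytic.
move=> D h g phi c oD D0 hg phiE gE; split.
  by move=> r I; exact: bpol_constant_solution.
exact: (solution_representation hm hn oD D0 hg phiE gE).
Qed.
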